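(* Let $N\ge 3$, let $n\geq 1$ and let $a_1,\dots,a_n$ be $n$ different points of $\mathbb{R}^N$. Put $V_{-\infty}(x):=\min_{1\le i\le n}|x-a_i|^{-2}$. Then for every $u\in H^1(\mathbb{R}^N)$ $$\int_{\mathbb{R}^N}|\nabla u|^2\,dx\ \ge\ \frac{(N-2)^2}{4}\int_{\mathbb{R}^N}V_{-\infty}|u|^2\,dx,$$ and the constant $\frac{(N-2)^2}{4}$ is sharp.
   Context: ''Sharp'' means that the inequality fails for some $u\in H^1(\mathbb{R}^N)$ if the constant $\frac{(N-2)^2}{4}$ is replaced by any larger constant. *)

(* Defs.v *)
From HB Require Import structures.
From mathcomp Require Import all_boot all_order all_algebra.
From mathcomp Require Import all_classical all_reals all_analysis.
From mathcomp Require Import measurable_realfun complex.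

Set Implicit Arguments.
Unset Strict Implicit.
Unset Printing Implicit Defensive.

Import Order.TTheory GRing.Theory Num.Theory.
Import numFieldNormedType.Exports.

Local Open Scope classical_set_scope.
Local Open Scope ring_scope.

Definition rv_display : measure_display.
Proof. exact: default_measure_display. Qed.

Section borel_rv.
Context (R : realType) (N : nat).

Let borel_set0 : <<s @open 'rV[R]_N >> set0.
Proof. exact: sigma_algebra0. Qed.

Let borel_setC (A : set 'rV[R]_N) :
  <<s @open 'rV[R]_N >> A -> <<s @open 'rV[R]_N >> (~` A).
Proof. exact: sigma_algebraC. Qed.

Let borel_bigcup (F : (set 'rV[R]_N)^nat) :
  (forall i, <<s @open 'rV[R]_N >> (F i)) ->
  <<s @open 'rV[R]_N >> (\bigcup_i F i).
Proof. exact: sigma_algebra_bigcup. Qed.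

HB.instance Definition _ := @isMeasurable.Build rv_display 'rV[R]_N
  <<s @open 'rV[R]_N >> borel_set0 borel_setC borel_bigcup.

End borel_rv.

Section lebesgue_rv.
Context (R : realType).

Definition consrv (N : nat) (p : 'rV[R]_N * R) : 'rV[R]_N.+1 :=
  \row_i oapp (p.1 0) p.2 (unlift ord0 i).

Lemma open_rv_measurable (N : nat) (U : set 'rV[R]_N) : open U -> measurable U.
Proof. by move=> oU; apply: sub_sigma_algebra. Qed.

Lemma open_rv_bigcup_ball (N : nat) (U : set 'rV[R]_N) : open U ->
  U = \bigcup_(p in [set p : 'rV[rat]_N * nat |
        ball (map_mx ratr p.1 : 'rV[R]_N) p.2.+1%:R^-1 `<=` U])
      ball (map_mx ratr p.1 : 'rV[R]_N) p.2.+1%:R^-1.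
Proof.
move=> oU; apply/seteqP; split; last by move=> x [p /= pU /pU].
move=> x Ux.
have /nbhs_ballP[e /= e0 xeU] : nbhs x U by apply: open_nbhs_nbhs.
have e20 : 0 < e / 2 by rewrite divr_gt0.
have [k _ ke] := near_infty_natSinv_lt (PosNum e20).
have {ke}ke : k.+1%:R^-1 < e / 2 :> R by apply: (ke k) => /=.
have d0 : 0 < k.+1%:R^-1 :> R by rewrite invr_gt0.
have Q j : {q : rat | ratr q \in `](x 0 j - k.+1%:R^-1), (x 0 j + k.+1%:R^-1)[ }.
  by apply/cid; apply: rat_in_itvoo; rewrite ltrD2l gtrN.
have xq : ball (map_mx ratr (\row_j sval (Q j)) : 'rV[R]_N) k.+1%:R^-1 x.
  split=> // i j; rewrite !mxE ord1 -ball_normE /=.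
  case: (Q j) => q /=; rewrite in_itv/= => /andP[qx xq].
  by rewrite ltr_distl xq andbT.
exists (\row_j sval (Q j), k) => //= y qy; apply: xeU.
rewrite [e]splitr; apply: ball_triangle (le_ball (ltW ke) qy).
by apply: ball_sym; apply: le_ball xq; exact: ltW.
Qed.

Lemma measurable_consrv (N : nat) : measurable_fun setT (@consrv N).
Proof.
apply: (@measurability _ _ _ _ _ _ (@open 'rV[R]_N.+1)) => //.
move=> _ [U oU <-]; rewrite setTI (open_rv_bigcup_ball oU) preimage_bigcup.
rewrite bigcup_mkcond; apply: countable_bigcupT_measurable => // -[q k].
case: ifP => // _ /=; set c := map_mx _ q; set d := _^-1.
have d0 : 0 < d by rewrite invr_gt0.
rewrite (_ : _ @^-1` _ =
    ball (\row_j c 0 (lift ord0 j) : 'rV[R]_N) d `*` ball (c 0 0) d); last first.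
  apply/seteqP; split=> [[v t] /= [_ cv]|[v t] /= [[_ cv] ct]].
    split.
      split=> // i j.
      by have := cv 0 (lift ord0 j); rewrite !mxE liftK ord1.
    by have := cv 0 0; rewrite !mxE unlift_none.
  split; first by [].
  move=> i j; rewrite (ord1 i) [X in ball _ _ X]mxE; case: (unliftP ord0 j) => [k'|] -> //.
  by have := cv 0 k'; rewrite mxE.
apply: measurableX; last exact: measurable_ball.
by apply: open_rv_measurable; exact: ball_open.
Qed.

Section consrv_measure.
Context (N : nat) (mu : {measure set 'rV[R]_N -> \bar R}).
Local Open Scope ereal_scope.

Definition consrv_measure : set 'rV[R]_N.+1 -> \bar R :=
  pushforward (mu \x @lebesgue_measure R) (@consrv N).

Let consrv_measure0 : consrv_measure set0 = 0.
Proof. by rewrite /consrv_measure /pushforward preimage_set0 measure0. Qed.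

Let consrv_measure_ge0 A : 0 <= consrv_measure A.
Proof. by rewrite /consrv_measure /pushforward measure_ge0. Qed.

Let consrv_measure_sigma_additive : semi_sigma_additive consrv_measure.
Proof.
pose pmu := measure_function_pushforward__canonical__measure_function_Measure
  (mu \x @lebesgue_measure R) (@measurable_consrv N).
exact: (@measure_semi_sigma_additive _ _ _ pmu).
Qed.

HB.instance Definition _ := isMeasure.Build _ _ _ consrv_measure
  consrv_measure0 consrv_measure_ge0 consrv_measure_sigma_additive.

End consrv_measure.

(* R^N is 'rV[R]_N with its Borel sigma-algebra; Lebesgue measure on it is the
   N-fold product of the one on R (see lebesgue_rv_box). *)
Fixpoint lebesgue_rv (N : nat) : {measure set 'rV[R]_N -> \bar R} :=
  match N with
  | 0 => dirac (0 : 'rV[R]_0)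
  | N'.+1 => consrv_measure (lebesgue_rv N')
  end.

Lemma measurable_coord (N : nat) (i : 'I_N) :
  measurable_fun setT (fun x : 'rV[R]_N => x 0 i).
Proof.
apply: (measurability _ (RGenOpens.measurableE R)) => _ [_ [a [b ->]] <-].
rewrite setTI; apply: open_rv_measurable; apply: open_comp.
  by move=> x _; exact: coord_continuous.
exact: interval_open.
Qed.

Lemma measurable_box (N : nat) (A : 'I_N -> set R) :
  (forall i, measurable (A i)) ->
  measurable [set x : 'rV[R]_N | forall i, A i (x 0 i)].
Proof.
move=> mA.
rewrite (_ : [set _ | _] =
    \bigcap_(i in setT) ((fun x : 'rV[R]_N => x 0 i) @^-1` A i)).
  apply: fin_bigcap_measurable => // i _.
  by rewrite -[X in measurable X]setTI; exact: measurable_coord.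
by apply/seteqP; split=> x /= h i; [move=> _; exact: (h i)|exact: (h i I)].
Qed.

Lemma lebesgue_rv_box (N : nat) (A : 'I_N -> set R) :
  (forall i, measurable (A i)) ->
  lebesgue_rv N [set x | forall i, A i (x 0 i)] =
  (\prod_(i < N) lebesgue_measure (A i))%E.
Proof.
elim: N A => [|N IH] A mA.
  by rewrite big_ord0 /= diracE mem_set //= => -[].
rewrite big_ord_recl /= /consrv_measure /pushforward.
rewrite (_ : _ @^-1` _ =
  [set x : 'rV[R]_N | forall i, A (lift ord0 i) (x 0 i)] `*` A ord0).
  rewrite product_measure1E.
  - by rewrite (IH (A \o lift ord0)) 1?muleC // => i; exact: (mA _).
  - exact: (@measurable_box N (A \o lift ord0) (fun i => mA _)).
  - exact: (mA _).
apply/seteqP; split=> [[v t] /= h|[v t] /= [h h0] i].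
  split; first by move=> i; have := h (lift ord0 i); rewrite mxE liftK.
  by have := h ord0; rewrite mxE unlift_none.
by rewrite mxE; case: (unliftP ord0 i) => [j|] ->.
Qed.

End lebesgue_rv.

Section sobolev.
Context (R : realType) (N : nat).
Implicit Types (f phi : 'rV[R]_N -> R) (u : 'rV[R]_N -> R[i])
  (g : 'I_N -> 'rV[R]_N -> R[i]).

Local Notation mu := (lebesgue_rv R N).

(* The norm `|x| of the library on 'rV[R]_N is the sup norm. *)
Definition enorm (x : 'rV[R]_N) : R := Num.sqrt (\sum_(i < N) x 0 i ^+ 2).

Definition partial (i : 'I_N) f : 'rV[R]_N -> R := 'D_(delta_mx 0 i) f.

Definition smooth f : Prop := forall s : seq 'I_N,
  continuous (foldr partial f s) /\
  forall i x, derivable (foldr partial f s) x (delta_mx 0 i).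

Definition test_function phi : Prop :=
  smooth phi /\ compact (closure [set x | phi x != 0]).

Definition weak_partial (i : 'I_N) f f' : Prop := forall phi,
  test_function phi ->
  \int[mu]_x (f x * partial i phi x) = - \int[mu]_x (f' x * phi x).

(* Elements of L^2 and H^1 are represented by Borel functions. *)
Definition L2 u : Prop :=
  (@complex.Re R \o u \in Lfun mu 2%:E) /\
  (@complex.Im R \o u \in Lfun mu 2%:E).

(* Real test functions suffice for complex-valued u, the defining identity
   being linear in the test function. *)
Definition weak_gradient u g : Prop := forall i,
  [/\ L2 (g i),
      weak_partial i (@complex.Re R \o u) (@complex.Re R \o g i) &
      weak_partial i (@complex.Im R \o u) (@complex.Im R \o g i)].

Definition H1 u : Prop := L2 u /\ exists g, weak_gradient u g.

Local Open Scope ereal_scope.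

(* Inverses are taken in \bar R, where 0^-1 = +oo. *)
Definition V_minfty (n : nat) (a : 'I_n -> 'rV[R]_N) (x : 'rV[R]_N) : \bar R :=
  \big[mine/+oo]_(i < n) ((enorm (x - a i) ^+ 2)%:E)^-1.

End sobolev.

(* Main.v *)
Require Import Defs.
From HB Require Import structures.
From mathcomp Require Import all_boot all_order all_algebra.
From mathcomp Require Import all_classical all_reals all_analysis.
From mathcomp Require Import measurable_realfun complex ring lra zify.

Set Implicit Arguments.
Unset Strict Implicit.
Unset Printing Implicit Defensive.

Import Order.TTheory GRing.Theory Num.Theory.
Import numFieldNormedType.Exports.

Local Open Scope classical_set_scope.
Local Open Scope ring_scope.

(** The inequality is one-pole Hardy and the sharpness is Hardy at infinity.

    The minimum defining [V_minfty] is attained at the farthest pole.  Hence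
    [V_minfty a x <= |x - a_i|^-2] for any one pole, and the inequality
    follows from the classical Hardy inequality with that single pole
    ([hardy_one_pole]), applied to the real and imaginary parts
    ([hardy_farthest_pole]).  On the other hand all distances to the poles are
    equivalent to [|x|] at infinity, so that functions spread out far away see
    the potential [|x|^-2], and the constant cannot be better than Hardy's
    ([sharp_constant]).

    Hardy's inequality is usually proved for smooth functions and extended by
    density.  Here it is proved directly for a function [p] in [L^2] with weak
    partial derivatives [g_i] in [L^2], through a pointwise representation of
    [p].  For a test function [phi] and [T_r x = a + r^2 (x - a)], the
    derivative in [r] of [r^(2N) phi (T_r x)] is the divergence in [x] of
    [2 r^(2N-1) (x - a) phi (T_r x)].  Integrating over [0 < r < 1] writes
    [phi] as an average of divergences of test fields
    ([integral_dilation_div]); the definition of weak derivatives, Fubini and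
    a change of variables then give [\int p phi = - \int G phi] with
      [G y = \int_0^1 2 r^-3 g (a + r^-2 (y - a)) . (y - a) dr],
    so that [p = - G] almost everywhere by the fundamental lemma of the
    calculus of variations ([ae_eq0_test]).  With [s = r^-2] this is the
    fundamental theorem of calculus along the ray from [y] to infinity.
    Cauchy-Schwarz in [r] with the weight [r^(N-3)] and Tonelli finally bound
    [\int p^2 / |y - a|^2] by [4 / (N-2)^2 \int |g|^2].  The exponent 2 in
    [r^2] keeps all weights integer powers of [r].

    For sharpness, put [q x = B + |x|^2] and take [u = q^-b / (1 + d q)] with
    [4 b] slightly larger than [N - 2].  For [d > 0] the function is in [H^1],
    and as [d] tends to 0 the ratio of the two integrals is asymptotically at
    most [4 b^2 (1 + eta)], where [|x - a_i|^2 <= (1 + eta) q x] if [B] is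
    large.  Dominated convergence makes this rigorous, since the common factor
    [q^-(2b+1)] is integrable. *)

(** * Lebesgue measure on R^N *)
Definition box (R : realType) (N : nat) (l r : 'I_N -> R) : set 'rV[R]_N :=
  [set x | forall i, x 0 i \in `]l i, r i[].

Definition cube (R : realType) (N : nat) (K : R) : set 'rV[R]_N :=
  box (fun=> - K) (fun=> K).
Arguments cube {R} N K _.

Definition boxes (R : realType) (N : nat) : set (set 'rV[R]_N) :=
  [set A | exists l r, A = box l r].

(** Lebesgue measure under a name of its own, to which the sigma-finite
    structure can be attached for every dimension at once. *)
Definition vol (R : realType) (N : nat) : set 'rV[R]_N -> \bar R :=
  lebesgue_rv R N.
Arguments vol R N _ : clear implicits.

HB.instance Definition _ (R : realType) (N : nat) := Measure.on (vol R N).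

Definition affine (R : realType) (N : nat) (c : R) (b x : 'rV[R]_N) :
  'rV[R]_N := c *: x + b.

Section volume.
Context (R : realType).

Lemma measurable_box_oo N (l r : 'I_N -> R) : measurable (box l r).
Proof. by apply: (@measurable_box R N (fun i => `]l i, r i[%classic)) => i. Qed.

Lemma measurable_cube N (K : R) : measurable (cube N K).
Proof. exact: measurable_box_oo. Qed.

Lemma ball_box N (q : 'rV[R]_N) (d : R) : 0 < d ->
  ball q d = box (fun i => q 0 i - d) (fun i => q 0 i + d).
Proof.
move=> d0; apply/seteqP; split=> x.
  move=> [_ qx] i; have := qx 0 i; rewrite -ball_normE /= in_itv/=.
  by rewrite distrC ltr_distl.
move=> qx; split=> // i j; rewrite (ord1 i) -ball_normE /=.
by have := qx j; rewrite in_itv/= distrC ltr_distl.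
Qed.

(** Open sets are countable unions of boxes, because rational balls of the sup
    norm are boxes; hence boxes generate the Borel sets. *)
Lemma open_box_bigcup N (U : set 'rV[R]_N) : open U ->
  exists B : (set 'rV[R]_N)^nat,
    (forall k, boxes (B k) \/ B k = set0) /\ U = \bigcup_k B k.
Proof.
move=> oU; pose B (p : 'rV[rat]_N * nat) :=
  ball (map_mx ratr p.1 : 'rV[R]_N) p.2.+1%:R^-1.
pose D := [set p : 'rV[rat]_N * nat | B p `<=` U].
pose C k := if unpickle k is Some p then if p \in D then B p else set0
            else set0.
exists C; split=> [k|].
  rewrite /C; case: unpickle => [p|]; last by right.
  case: ifP => _; last by right.
  by left; rewrite /B ball_box; [eexists; eexists|rewrite invr_gt0].
rewrite [LHS](open_rv_bigcup_ball oU); apply/seteqP; split=> x.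
  by move=> [p pU px]; exists (pickle p) => //; rewrite /C pickleK mem_set.
move=> [k _]; rewrite /C; case: unpickle => [p|//].
by case: ifPn => // /set_mem pD px; exists p.
Qed.

Lemma measurable_boxes N :
  @measurable _ ('rV[R]_N : measurableType _) = <<s @boxes R N >>.
Proof.
apply/seteqP; split.
  apply: smallest_sub; first exact: smallest_sigma_algebra.
  move=> U /open_box_bigcup[B [bB ->]].
  apply: sigma_algebra_bigcup => k; case: (bB k) => [bk|->].
    exact: sub_sigma_algebra.
  exact: sigma_algebra0.
apply: smallest_sub; first exact: sigma_algebra_measurable.
by move=> _ [l [r ->]]; exact: measurable_box_oo.
Qed.

Lemma boxes_setI_closed N : setI_closed (@boxes R N).
Proof.
move=> _ _ [l [r ->]] [l' [r' ->]].
exists (fun i => Num.max (l i) (l' i)), (fun i => Num.min (r i) (r' i)).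
apply/seteqP; split=> x /=.
  move=> [xA xB] i; move: (xA i) (xB i); rewrite !in_itv/=.
  by rewrite gt_max lt_min => /andP[-> ->] /andP[-> ->].
move=> xAB; split=> i; move: (xAB i); rewrite !in_itv/= gt_max lt_min;
  by move=> /andP[/andP[? ?] /andP[? ?]]; apply/andP.
Qed.

Lemma bigcup_cube N : \bigcup_k cube N k%:R = [set: 'rV[R]_N].
Proof.
rewrite -subTset => x _.
have [k xk] : exists k : nat, `|x| < k%:R.
  exists (Num.truncn `|x|).+1; exact: truncnS_gt.
exists k => // i; rewrite in_itv/=.
rewrite -ltr_norml; apply: le_lt_trans xk.
by rewrite [leRHS]/Num.norm/= mx_normrE;
  exact: (le_bigmax _ (fun ij => `|x ij.1 ij.2|) (0, i)).
Qed.

(** As boxes generate, measurability into R^N is checked coordinatewise. *)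
Lemma measurable_rv d (T : measurableType d) (D : set T) N
    (f : T -> 'rV[R]_N) :
  (forall i, measurable_fun D (fun x => f x 0 i)) -> measurable_fun D f.
Proof.
move=> mf mD; apply: (measurability _ (measurable_boxes N)) => //.
move=> _ [_ [l [r ->]] <-].
rewrite (_ : _ `&` _ = D `&` \bigcap_(i in setT)
    (D `&` (fun x => f x 0 i) @^-1` `]l i, r i[%classic)).
  apply: measurableI => //; apply: fin_bigcap_measurable => // i _.
  exact: mf.
apply/seteqP; split=> x /= [Dx h]; split => //.
  by move=> i _; split => //; exact: h.
by move=> i; exact: (h i I).2.
Qed.

Lemma continuous_measurable_rv N (f : 'rV[R]_N -> R) : continuous f ->
  measurable_fun setT f.
Proof.
move=> cf; apply: (measurability _ (RGenOpens.measurableE R)).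
move=> _ [_ [a [b ->]] <-]; rewrite setTI; apply: open_rv_measurable.
apply: open_comp; [by move=> x _; exact: cf|exact: interval_open].
Qed.

Lemma vol_box N (l r : 'I_N -> R) :
  vol _ _ (box l r) = (\prod_(i < N) lebesgue_measure `]l i, r i[%classic)%E.
Proof. by apply: (@lebesgue_rv_box R N (fun i => `]l i, r i[%classic)) => i. Qed.

Lemma vol_cube_lty N (K : R) : (vol _ _ (cube N K) < +oo)%E.
Proof.
rewrite /cube vol_box -ge0_fin_numE; last by apply: prode_ge0 => i _.
apply: prode_fin_num => i _; rewrite lebesgue_measure_itv; case: ifP => //.
Qed.

Lemma vol_sigma_finite N : sigma_finite setT (vol R N).
Proof.
exists (fun k => cube N k%:R); first by rewrite bigcup_cube.
by move=> k; split; [exact: measurable_cube|exact: vol_cube_lty].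
Qed.

HB.instance Definition _ N :=
  @Measure_isSigmaFinite.Build _ _ _ (vol R N) (@vol_sigma_finite N).

Lemma measurable_affine N (c : R) (b : 'rV[R]_N) :
  measurable_fun setT (affine c b).
Proof.
apply: measurable_rv => i.
under eq_fun do rewrite !mxE.
apply: measurable_funD => //; apply: measurable_funM => //.
exact: measurable_coord.
Qed.

(** Both sides are measures in [A] that agree on boxes, where the claim is the
    scaling of lengths of intervals. *)
Lemma vol_affine N (c : R) (b : 'rV[R]_N) (A : set 'rV[R]_N) : 0 < c ->
  measurable A -> (vol R N (affine c b @^-1` A) = (c^-1 ^+ N)%:E * vol R N A)%E.
Proof.
move=> c0 mA.
have k0 : 0 <= c^-1 ^+ N by rewrite exprn_ge0// invr_ge0 ltW.
pose m1 := measure_function_pushforward__canonical__measure_function_Measure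
  (vol R N) (measurable_affine c b).
pose m2 := mscale (NngNum k0) (vol R N).
suff : m1 A = m2 A by [].
have cvt (x : 'rV[R]_N) i l r : (affine c b x 0 i \in `]l, r[) =
    (x 0 i \in `](l - b 0 i) / c, (r - b 0 i) / c[).
  by rewrite !in_itv/= !mxE ltr_pdivrMr// ltr_pdivlMr// ltrBlDr ltrBrDr mulrC.
have m12 l r : m1 (box l r) = m2 (box l r).
  rewrite /m1 /m2 /mscale /= /pushforward.
  rewrite (_ : _ @^-1` _ = box (fun i => (l i - b 0 i) / c)
                              (fun i => (r i - b 0 i) / c)); last first.
    by apply/seteqP; split=> x h i; have := h i; rewrite /= cvt.
  have -> : c^-1 ^+ N = \prod_(i < N) c^-1 by rewrite prodr_const card_ord.
  rewrite !vol_box -prodEFin -big_split /=; apply: eq_bigr => i _.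
  rewrite !lebesgue_measure_itv /= !lte_fin ltr_pM2r ?invr_gt0// ltrD2r.
  by case: ifP => _; rewrite ?mule0// -!EFinB -EFinM; congr EFin; ring.
apply: (measure_unique (@boxes R N) (fun k => cube N k%:R)) => //.
- exact: measurable_boxes.
- exact: boxes_setI_closed.
- by move=> k; eexists; eexists; reflexivity.
- exact: bigcup_cube.
- by move=> _ [l [r ->]]; exact: m12.
- move=> k; rewrite m12 /m2 /mscale /=; apply: lte_mul_pinfty => //.
  exact: vol_cube_lty.
Qed.

Lemma ge0_integral_affine N (c : R) (b : 'rV[R]_N) (f : 'rV[R]_N -> \bar R) :
  0 < c -> measurable_fun setT f -> (forall x, 0 <= f x)%E ->
  (\int[vol R N]_x f (affine c b x) = (c^-1 ^+ N)%:E * \int[vol R N]_x f x)%E.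
Proof.
move=> c0 mf f0.
have k0 : 0 <= c^-1 ^+ N by rewrite exprn_ge0// invr_ge0 ltW.
have -> : (\int[vol R N]_x f (affine c b x) =
    \int[pushforward (vol R N) (affine c b)]_x f x)%E.
  by rewrite [RHS]ge0_integral_pushforward//; exact: measurable_affine.
rewrite -[(_ ^+ N)%:E]/((NngNum k0)%:num%:E) -ge0_integral_mscale//.
pose m2 : {measure set 'rV[R]_N -> \bar R} := mscale (NngNum k0) (vol R N).
pose m1 : {measure set 'rV[R]_N -> \bar R} :=
  measure_function_pushforward__canonical__measure_function_Measure
  (vol R N) (measurable_affine c b).
apply: (@eq_measure_integral _ _ _ _ m2 m1 f) => A mA _.
exact: vol_affine.
Qed.

Lemma integral_affine N (c : R) (b : 'rV[R]_N) (f : 'rV[R]_N -> \bar R) :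
  0 < c -> (vol R N).-integrable setT f ->
  (\int[vol R N]_x f (affine c b x) = (c^-1 ^+ N)%:E * \int[vol R N]_x f x)%E.
Proof.
move=> c0 fi; have mf := measurable_int _ fi.
rewrite integralE [in RHS]integralE.
rewrite muleBr//; last first.
  by rewrite fin_num_adde_defl// fin_numN; exact: integrable_neg_fin_num.
congr (_ - _)%E; rewrite -(@ge0_integral_affine N c b)//.
- by apply: eq_integral => x _; rewrite !funeposE.
- exact: measurable_funepos.
- by apply: eq_integral => x _; rewrite !funenegE.
- exact: measurable_funeneg.
Qed.

Lemma measurable_invr : measurable_fun setT (GRing.inv : R -> R).
Proof.
have -> : [set: R] = [set x | x != 0] `|` [set 0].
  by apply/seteqP; split=> // x _ /=; case: (eqVneq x 0); [right|left].
have o0 : open [set x : R | x != 0].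
  have := @open_neq R 0.
  by rewrite /=.
apply/measurable_funU => //; first exact: open_measurable.
split; last exact: measurable_fun_set1.
by apply: open_continuous_measurable_fun => // x /[1!inE]; exact: inv_continuous.
Qed.

End volume.
(* Unification must not unfold the recursion on the dimension. *)
Opaque vol.

(** * Smooth test functions *)
Section flat.
Context (R : realType).

(** [flat 0] is the standard smooth function that vanishes on the negative
    half-line; the powers of [s^-1] make the family [flat m] closed under
    differentiation, up to linear combinations. *)
Definition flat (m : nat) (s : R) : R :=
  if 0 < s then s^-1 ^+ m * expR (- s^-1) else 0.

Lemma flat_ge0 m s : 0 <= flat m s.
Proof.
rewrite /flat; case: ifP => // s0.
by rewrite mulr_ge0 ?expR_ge0// exprn_ge0// invr_ge0 ltW.
Qed.

(** Quadratic smallness at 0, from one term of the exponential series. It makes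
    [flat m] differentiable at 0 with derivative 0. *)
Lemma flat_le_sqr m s : flat m s <= (m.+2)`!%:R * s ^+ 2.
Proof.
rewrite /flat; case: ifPn => [s0|_]; last by rewrite mulr_ge0// sqr_ge0.
have sV : 0 <= s^-1 by rewrite invr_ge0 ltW.
have := expR_ge1Dxn m.+1 sV; set f := _%:R => h.
have f0 : 0 < f by rewrite ltr0n fact_gt0.
have {}h : s^-1 ^+ m.+2 <= f * expR s^-1.
  rewrite mulrC -ler_pdivrMr//; apply: le_trans h.
  by rewrite lerDr.
rewrite expRN ler_pdivrMr ?expR_gt0//.
have -> : s^-1 ^+ m = s^-1 ^+ m.+2 * s ^+ 2.
  by rewrite -addn2 exprD -mulrA -exprMn mulVf ?gt_eqF// expr1n mulr1.
by rewrite [leRHS]mulrAC ler_pM2r// exprn_gt0.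
Qed.

Lemma flat_derive_pos (m : nat) (s : R) : 0 < s ->
  is_derive s 1 (flat m) (- m%:R * flat m.+1 s + flat m.+2 s).
Proof.
move=> s0.
have sn0 : s != 0 by rewrite gt_eqF.
apply: (@near_eq_is_derive R R^o R^o (fun t => t^-1 ^+ m * expR (- t^-1))).
- near=> t; rewrite /flat; case: ifPn => //; rewrite -leNgt => t0.
  have : 0 < t by near: t; exact: lt_nbhsr.
  by rewrite ltNge t0.
- have dV : is_derive s 1 (fun t : R => t^-1) (- s ^- 2 *: 1).
    exact: (@is_deriveV R id s 1 1 sn0 (is_derive_id _ _)).
  have dN : is_derive s 1 (fun t : R => - t^-1) (- (- s ^- 2 *: 1)).
    exact: is_deriveN dV.
  have dE := @is_derive1_comp R expR (fun t => - t^-1) s _ _ (is_derive_expR _) dN.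
  rewrite (_ : (fun t => _) =
    ((GRing.inv : R -> R) ^+ m * (expR \o (fun t => - t^-1)))); last first.
    by apply/funext => t; rewrite /= !fctE.
  apply: is_derive_eq (is_deriveM (is_deriveX m dV) dE) _.
  rewrite /flat s0 /GRing.scale !fctE /= !exprVn; case: m {dE} => [|m] /=.
    by rewrite !expr0; field.
  by rewrite !exprS; field; rewrite sn0 expf_neq0.
Unshelve. all: by end_near.
Qed.

Lemma is_derive_flat (m : nat) (s : R) :
  is_derive s 1 (flat m) (- m%:R * flat m.+1 s + flat m.+2 s).
Proof.
have [s0|s0|->] := ltgtP s 0.
- apply: (@near_eq_is_derive R R^o R^o (cst 0)).
  + near=> t; rewrite /flat; case: ifPn => // t0.
    have : t < 0 by near: t; exact: lt_nbhsl.
    by move=> /(lt_trans t0); rewrite ltxx.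
  + rewrite /flat ltNge ltW// mulr0 addr0; exact: is_derive_cst.
- exact: flat_derive_pos.
rewrite /flat ltxx mulr0 addr0.
set C : R := (m.+2)`!%:R.
have h0 : (fun h : R => h^-1 *: (flat m (h *: 1 + 0) - flat m 0)) @ 0^' --> 0.
  apply/cvgr0Pnorm_le => e e0.
  near=> h.
  have hn0 : h != 0 by near: h; exact: nbhs_dnbhs_neq.
  rewrite addr0 {2}/flat ltxx subr0 [h *: 1]mulr1 normrZ normfV.
  rewrite ler_pdivrMl ?normr_gt0// (ger0_norm (flat_ge0 _ _)).
  apply: le_trans (flat_le_sqr _ _) _.
  rewrite -real_normK ?num_real// expr2 mulrCA ler_pM2l ?normr_gt0//.
  rewrite -ler_pdivlMl ?ltr0n ?fact_gt0//.
  near: h; apply: dnbhs0_le; rewrite mulr_gt0// invr_gt0 ltr0n fact_gt0//.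
split; first by apply/cvg_ex; exists 0.
exact: cvg_lim h0.
Unshelve. all: by end_near.
Qed.
End flat.

(** A class of functions on R^N that contains enough bumps, and that is closed
    under partial derivatives by construction; smoothness in the sense of
    [smooth], which quantifies over all iterated partial derivatives, is then
    an induction on the class. *)
Inductive elementary (R : realType) (N : nat) : ('rV[R]_N -> R) -> Prop :=
| elementary_cst c : elementary (fun=> c)
| elementary_coord i : elementary (fun x => x 0 i)
| elementary_add f g : elementary f -> elementary g -> elementary (fun x => f x + g x)
| elementary_mul f g : elementary f -> elementary g -> elementary (fun x => f x * g x)
| elementary_flat m f : elementary f -> elementary (fun x => flat m (f x)).

Section elementary.
Context (R : realType) (N : nat).
Implicit Types (f g : 'rV[R]_N -> R) (c : R) (b x v : 'rV[R]_N).

Lemma differentiable_flat m (s : R) : differentiable (flat m) s.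
Proof. by apply/derivable1_diffP; have [] := is_derive_flat m s. Qed.

Lemma elementary_differentiable f : elementary f -> forall x, differentiable f x.
Proof.
elim=> {f} [c|i|f g _ df _ dg|f g _ df _ dg|m f _ df] x.
- exact: differentiable_cst.
- exact: differentiable_coord.
- exact: differentiableD.
- exact: differentiableM.
- by apply: (@differentiable_comp _ _ _ _ f (flat m)) => //;
    exact: differentiable_flat.
Qed.

Lemma elementary_derivable f : elementary f -> forall x v, derivable f x v.
Proof. by move=> nf x v; exact/diff_derivable/elementary_differentiable. Qed.

Lemma elementary_continuous f : elementary f -> continuous f.
Proof. by move=> nf x; exact/differentiable_continuous/elementary_differentiable. Qed.

Lemma is_derive_comp_real (F : R -> R) (dF : R) f x v :
  is_derive (f x) 1 F dF -> differentiable f x ->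
  is_derive x v (fun y => F (f y)) (dF * 'D_v f x).
Proof.
move=> [dF1 dFE] df; have /derivable1_diffP dFd := dF1.
have dFf : differentiable (F \o f) x by exact: differentiable_comp.
split; first exact/diff_derivable.
rewrite -[fun y => _]/(F \o f) !deriveE//.
by rewrite (@diff_comp _ _ _ _ f F)//= diff1E// derive1E dFE [RHS]mulrC.
Qed.

Lemma partial_coord i j x : partial i (fun y => y 0 j) x = (j == i)%:R.
Proof.
have := @derive_mx R _ 1 N id x (delta_mx 0 i) (@derivable_id _ _ _ _).
by rewrite /partial derive_id => /matrixP/(_ 0 j); rewrite !mxE eqxx => <-.
Qed.

Lemma elementary_partial i f : elementary f -> elementary (partial i f).
Proof.
elim=> {f} [c|j|f g nf df ng dg|f g nf df ng dg|m f nf df].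
- rewrite (_ : partial i _ = fun=> 0); first exact: elementary_cst.
  by apply/funext => x; rewrite /partial derive_cst.
- rewrite (funext (partial_coord i j)); exact: elementary_cst.
- rewrite (_ : partial i _ = fun x => partial i f x + partial i g x).
    exact: elementary_add.
  by apply/funext => x; rewrite /partial deriveD//; exact: elementary_derivable.
- rewrite (_ : partial i _ = fun x => f x * partial i g x + g x * partial i f x).
    by apply: elementary_add; exact: elementary_mul.
  by apply/funext => x; rewrite /partial deriveM//; exact: elementary_derivable.
- rewrite (_ : partial i _ = fun x =>
    (- m%:R * flat m.+1 (f x) + flat m.+2 (f x)) * partial i f x).
    apply: elementary_mul => //; apply: elementary_add; last exact: elementary_flat.
    by apply: elementary_mul; [exact: elementary_cst|exact: elementary_flat].
  apply/funext => x; rewrite /partial.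
  by have [] := is_derive_comp_real (delta_mx 0 i) (is_derive_flat m (f x))
    (elementary_differentiable nf x).
Qed.

Lemma elementary_smooth f : elementary f -> smooth f.
Proof.
move=> nf s; have {nf} : elementary (foldr (@partial R N) f s).
  by elim: s => //= i s; exact: elementary_partial.
by move=> nf; split=> [|i x]; [exact: elementary_continuous|exact: elementary_derivable].
Qed.

Lemma elementary_affine f c b : elementary f -> elementary (fun x => f (affine c b x)).
Proof.
elim=> {f} [d|i|f g _ nf _ ng|f g _ nf _ ng|m f _ nf].
- exact: elementary_cst.
- rewrite (_ : (fun x => _) = fun x => c * x 0 i + b 0 i); last first.
    by apply/funext => x; rewrite !mxE.
  apply: elementary_add; last exact: elementary_cst.
  by apply: elementary_mul; [exact: elementary_cst|exact: elementary_coord].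
- exact: elementary_add.
- exact: elementary_mul.
- exact: elementary_flat.
Qed.

Lemma elementary_prod (I : Type) (s : seq I) (F : I -> 'rV[R]_N -> R) :
  (forall i, elementary (F i)) -> elementary (fun x => \prod_(i <- s) F i x).
Proof.
move=> nF; elim: s => [|i s IH].
  by under eq_fun do rewrite big_nil; exact: elementary_cst.
by under eq_fun do rewrite big_cons; exact: elementary_mul.
Qed.

(** Linearity of the differential in its direction. *)
Lemma derive_sum_partial f x v : differentiable f x ->
  'D_v f x = \sum_(i < N) v 0 i * partial i f x.
Proof.
move=> df; rewrite deriveE// {1}(row_sum_delta v) linear_sum.
apply: eq_bigr => i _; rewrite linearZ /=.
by rewrite /partial deriveE.
Qed.

Lemma partial_affine f c b i x : (forall y, differentiable f y) ->
  partial i (fun y => f (affine c b y)) x = c * partial i f (affine c b x).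
Proof.
move=> df; rewrite /partial [X in _ = _ * X]deriveE//.
have -> : c * 'd f (affine c b x) (delta_mx 0 i) =
    'd f (affine c b x) (c *: delta_mx 0 i) by rewrite linearZ.
rewrite -deriveE// /derive.
(* The difference quotient of [f \o affine c b] in the direction [e] is that of
   [f] in the direction [c *: e]. *)
suff -> : (fun h : R => h^-1 *: (((fun y => f (affine c b y)) \o shift x)
      (h *: delta_mx 0 i) - f (affine c b x))) =
    (fun h : R => h^-1 *: ((f \o shift (affine c b x))
      (h *: (c *: delta_mx 0 i)) - f (affine c b x))) by [].
apply/funext => h /=; congr (_ *: (f _ - _)).
by rewrite /affine scalerDr !scalerA [c * h]mulrC addrA.
Qed.
End elementary.

Section bump.
Context (R : realType).

Lemma flat_le0 m (s : R) : s <= 0 -> flat m s = 0.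
Proof. by rewrite /flat; case: ltgtP. Qed.

Lemma flat0_le1 (s : R) : flat 0 s <= 1.
Proof.
rewrite /flat; case: ifPn => // s0; rewrite expr0 mul1r -expR0 ler_expR.
by rewrite oppr_le0 invr_ge0 ltW.
Qed.

Lemma flat0_cvg1 (s : R) : 0 < s ->
  (fun k => flat 0 (k.+1%:R * s)) @ \oo --> (1 : R).
Proof.
move=> s0; rewrite (_ : (fun k => _) = fun k => expR (- (harmonic k * s^-1))).
  rewrite -[X in _ --> X](_ : expR (- (0 * s^-1)) = _); last first.
    by rewrite mul0r oppr0 expR0.
  apply: continuous_cvg; first exact: continuous_expR.
  by apply: cvgN; apply: cvgMl; exact: cvg_harmonic.
apply/funext => k; rewrite /flat pmulr_rgt0// s0 expr0 mul1r invfM//.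
Qed.

(** The scaled arguments make [bump l r k] increase to the indicator of
    [box l r] as [k] tends to infinity. *)
Definition bump N (l r : 'I_N -> R) (k : nat) (x : 'rV[R]_N) : R :=
  \prod_(i < N) (flat 0 (k.+1%:R * (x 0 i - l i)) *
                 flat 0 (k.+1%:R * (r i - x 0 i))).

Lemma elementary_bump N l r k : elementary (@bump N l r k).
Proof.
apply: elementary_prod => i; apply: elementary_mul; apply: elementary_flat;
  (apply: elementary_mul; first exact: elementary_cst).
  by apply: elementary_add; [exact: elementary_coord|exact: elementary_cst].
rewrite (_ : (fun x : 'rV[R]_N => _) = fun x => r i + (-1) * x 0 i).
  apply: elementary_add; first exact: elementary_cst.
  by apply: elementary_mul; [exact: elementary_cst|exact: elementary_coord].
by apply/funext => x; rewrite mulN1r.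
Qed.

Lemma bump_ge0 N l r k x : 0 <= @bump N l r k x.
Proof. by apply: prodr_ge0 => i _; rewrite mulr_ge0// flat_ge0. Qed.

Lemma bump_le1 N l r k x : @bump N l r k x <= 1.
Proof.
apply: Num.Theory.prodr_ile1 => i _; rewrite mulr_ge0 ?flat_ge0//=.
by rewrite mulr_ile1// ?flat_ge0 ?flat0_le1.
Qed.

Lemma bump_out N l r k x : ~ box l r x -> @bump N l r k x = 0.
Proof.
move=> /existsNP[i /negP]; rewrite in_itv/= negb_and -!leNgt => xi.
rewrite /bump (bigD1 i)//=.
case/orP: xi => xi; last rewrite [X in _ * X * _]flat_le0 ?(mul0r, mulr0)//;
  first rewrite flat_le0 ?mul0r//; by rewrite pmulr_rle0// subr_le0.
Qed.

Lemma bump_cvg1 N l r x : box l r x -> @bump N l r k x @[k --> \oo] --> (1 : R).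
Proof.
move=> lxr; rewrite /bump; elim: (index_enum _) => [|i s IH].
  by under eq_fun do rewrite big_nil; exact: cvg_cst.
under eq_fun do rewrite big_cons.
have := lxr i; rewrite in_itv/= -[l i < _]subr_gt0 -[_ < r i]subr_gt0.
move=> /andP[/flat0_cvg1 lx /flat0_cvg1 xr].
by have := cvgM (cvgM lx xr) IH; rewrite !mulr1; exact.
Qed.

Lemma box_sub_cube N (l r : 'I_N -> R) :
  exists K : nat, box l r `<=` cube N K%:R.
Proof.
pose M := \sum_(i < N) (`|l i| + `|r i|).
exists (Num.truncn M).+1 => x xb i.
have := xb i; rewrite !in_itv/= => /andP[lx xr].
have MK : M < (Num.truncn M).+1%:R by exact: truncnS_gt.
have lrM : `|l i| + `|r i| <= M.
  by rewrite /M (bigD1 i)//= lerDl sumr_ge0// => j _; rewrite addr_ge0.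
have := ler_norm (r i); have := ler_norm (- l i); rewrite normrN.
have := normr_ge0 (r i); have := normr_ge0 (l i).
by move=> *; apply/andP; split; lra.
Qed.

Lemma compact_closed_cube N (K : R) :
  compact [set x : 'rV[R]_N | forall i, x 0 i \in `[- K, K]].
Proof.
apply: (@rV_compact R N (fun=> `[- K, K]%classic)) => i.
exact: segment_compact.
Qed.

Lemma test_elementary N (f : 'rV[R]_N -> R) (K : R) : elementary f ->
  (forall x, ~ cube N K x -> f x = 0) -> test_function f.
Proof.
move=> nf f0; split; first exact: elementary_smooth.
apply: (subclosed_compact _ (@compact_closed_cube N K)).
  exact: closed_closure.
have cK : closed [set x : 'rV[R]_N | forall i, x 0 i \in `[- K, K]].
  apply: compact_closed; [exact: norm_hausdorff|exact: compact_closed_cube].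
rewrite [X in _ `<=` X](closure_id _).1//; apply: closure_subset.
move=> x /= fx i; have : cube N K x by apply: contrapT => /f0 /eqP; exact/negP.
by move=> /(_ i); rewrite !in_itv/= => /andP[/ltW -> /ltW ->].
Qed.

End bump.

(** * The fundamental lemma of the calculus of variations *)
Section fundamental_lemma.
Context (R : realType) (N : nat).
Local Notation mu := (vol R N).

Lemma integrable_mul_cube (f phi : 'rV[R]_N -> R) (K M : R) :
  measurable_fun setT f -> mu.-integrable (cube N K) (EFin \o f) ->
  measurable_fun setT phi -> (forall x, `|phi x| <= M) ->
  (forall x, ~ cube N K x -> phi x = 0) ->
  mu.-integrable setT (fun x => (f x * phi x)%:E).
Proof.
move=> mf fi mphi phiM phi0.
have mc := @measurable_cube R N K.
have Mfi := integrableZl mc M fi.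
have /(integrable_mkcond _ mc) Mi := Mfi.
apply: (le_integrable measurableT _ _ Mi).
  by apply/measurable_EFinP; exact: measurable_funM.
move=> x _; rewrite /patch; case: ifPn => [_|/negP xK].
  rewrite /= !lee_fin !normrM mulrC; apply: ler_pM => //.
  by apply: le_trans (phiM x) _; exact: ler_norm.
by rewrite phi0 ?mulr0//= => cx; apply: xK; rewrite inE.
Qed.

(** Dominated convergence along the bumps approximating a box. *)
Lemma integral_box_eq0 (f : 'rV[R]_N -> R) (l r : 'I_N -> R) :
  measurable_fun setT f ->
  (forall K : nat, mu.-integrable (cube N K%:R) (EFin \o f)) ->
  (forall phi (K : nat), elementary phi -> (forall x, ~ cube N K%:R x -> phi x = 0) ->
    (\int[mu]_x (f x * phi x)%:E = 0)%E) ->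
  (\int[mu]_(x in box l r) (f x)%:E = 0)%E.
Proof.
move=> mf fi h; have [K lrK] := box_sub_cube l r.
pose F k x := (f x * bump l r k x)%:E.
have F0 k : (\int[mu]_x F k x = 0)%E.
  apply: (h _ K); first exact: elementary_bump.
  by move=> x xK; apply: bump_out => /lrK.
have mbox := @measurable_box_oo R N l r.
have mF k : measurable_fun setT (F k).
  apply/measurable_EFinP; apply: measurable_funM => //.
  by apply: continuous_measurable_rv; apply: elementary_continuous; exact: elementary_bump.
rewrite integral_mkcond.
have boxi : mu.-integrable (box l r) (EFin \o f).
  by apply: (integrableS _ _ lrK (fi K)) => //; exact: measurable_cube.
have [] := @dominated_convergence _ _ _ mu setT measurableT F
  ((EFin \o f) \_ (box l r)) (abse \o ((EFin \o f) \_ (box l r))) mF.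
- apply/(measurable_restrictT _ mbox).
  exact/measurable_funTS/measurable_EFinP.
- apply: aeW => x _ /=; rewrite /F patchE; case: ifPn => [/set_mem xb|/negP xb].
    apply: cvg_EFin; first by apply: nearW.
    by have := cvgM (cvg_cst (f x)) (bump_cvg1 xb); rewrite mulr1; exact.
  have b0 k : bump l r k x = 0 by apply: bump_out => xb'; apply: xb; rewrite inE.
  by under eq_fun do rewrite b0 mulr0; exact: cvg_cst.
- by apply: integrable_abse; exact/(integrable_mkcond _ mbox).
- apply: aeW => x k _ /=; rewrite /F patchE; case: ifPn => [/set_mem xb|/negP xb].
    rewrite /= lee_fin normrM ler_piMr// ger0_norm ?bump_ge0//.
    exact: bump_le1.
  by rewrite bump_out ?mulr0//= => xb'; apply: xb; rewrite inE.
move=> _ _; under eq_fun do rewrite F0.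
by move=> /cvg_lim <-//; rewrite lim_cst.
Qed.

(** The sets for which the conclusion holds form a Dynkin system containing the
    pi-system of boxes; intersecting with a cube keeps [f] integrable. *)
Lemma integral_cubeI_eq0 (f : 'rV[R]_N -> R) (K : R) (A : set 'rV[R]_N) :
  measurable_fun setT f -> mu.-integrable (cube N K) (EFin \o f) ->
  (forall l r, \int[mu]_(x in box l r) (f x)%:E = 0)%E ->
  measurable A -> (\int[mu]_(x in A `&` cube N K) (f x)%:E = 0)%E.
Proof.
move=> mf fi h mA; have mc := @measurable_cube R N K.
have mfE : measurable_fun setT (EFin \o f) by exact/measurable_EFinP.
pose P := [set A : set 'rV[R]_N | (\int[mu]_(x in A `&` cube N K) (f x)%:E = 0)%E].
suff : P A by [].
apply: (dynkin_induction (measurable_boxes R N)).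
- exact: boxes_setI_closed.
- by rewrite /P /= setTI; exact: h.
- move=> B bB; have : boxes (B `&` cube N K).
    by apply: boxes_setI_closed => //; eexists; eexists.
  by move=> [l [r BK]]; rewrite /P /= BK; exact: h.
- move=> S mS; rewrite /P /= => S0.
  have := h (fun=> - K) (fun=> K); rewrite -[box _ _]/(cube N K).
  rewrite -[X in integral _ X _](setIT (cube N K)) -(setUv S) setIUr.
  rewrite integral_setU//.
  + by rewrite setIC S0 add0e setIC.
  + exact: measurableI.
  + by apply: measurableI => //; exact: measurableC.
  + exact: measurable_funTS.
  + by apply/disj_setPS => x [[_ ?] [_]].
- move=> F mF tF PF; rewrite /P /= setI_bigcupl integral_bigcup.
  + by rewrite eseries0// => k _ _; exact: PF.
  + exact: trivIset_setIr.
  + by move=> k; exact: measurableI.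
  + apply: (integrableS mc _ _ fi); last by move=> x [k _ []].
    by apply: bigcup_measurable => k _; exact: measurableI.
- by rewrite -measurable_boxes.
Qed.

(** Testing against bumps gives zero integral on boxes, hence on all Borel
    subsets of a cube, hence [f = 0] almost everywhere on each cube. *)
Lemma ae_eq0_test (f : 'rV[R]_N -> R) :
  measurable_fun setT f ->
  (forall K : nat, mu.-integrable (cube N K%:R) (EFin \o f)) ->
  (forall phi (K : nat), elementary phi -> (forall x, ~ cube N K%:R x -> phi x = 0) ->
    (\int[mu]_x (f x * phi x)%:E = 0)%E) ->
  {ae mu, forall x, f x = 0}.
Proof.
move=> mf fi h.
have h0 l r : (\int[mu]_(x in box l r) (f x)%:E = 0)%E by exact: integral_box_eq0.
have fK (K : nat) : ae_eq mu (cube N K%:R) (EFin \o f) (cst 0%E).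
  have mc := @measurable_cube R N K%:R.
  apply: integral_ae_eq => // E EK mE; rewrite integral0.
  have <- : E `&` cube N K%:R = E by exact/setIidPl.
  exact: integral_cubeI_eq0.
have := ae_foralln fK; apply: filterS => x fx.
have : (\bigcup_k cube N k%:R) x by rewrite bigcup_cube.
by move=> [k _ xk]; have /(_ xk) [] := fx k.
Qed.

End fundamental_lemma.

(** * Iterated integrals over rectangles *)
Section fubini_rectangle.
Local Open Scope ereal_scope.
Context d1 d2 (T1 : measurableType d1) (T2 : measurableType d2) (R : realType).
Variable m1 : {sigma_finite_measure set T1 -> \bar R}.
Variable m2 : {sigma_finite_measure set T2 -> \bar R}.
Variables (D : set T1) (E : set T2).
Hypotheses (mD : measurable D) (mE : measurable E).
Variable f : T1 * T2 -> \bar R.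
Hypothesis mf : measurable_fun setT f.

(* Integrals over [D] and [E] are integrals over the whole spaces of the
   extension by 0, to which the theorems for product measures apply. *)
Let fDE := f \_ (D `*` E).

Let fDE1 x : (fun y => fDE (x, y)) =
  if x \in D then (fun y => f (x, y)) \_ E else cst 0.
Proof.
apply/funext => y; rewrite /fDE !patchE in_setX /=.
by case: (x \in D) => //=; rewrite patchE.
Qed.

Let fDE2 y : (fun x => fDE (x, y)) =
  if y \in E then (fun x => f (x, y)) \_ D else cst 0.
Proof.
apply/funext => x; rewrite /fDE !patchE in_setX /= andbC.
by case: (y \in E) => //=; rewrite patchE.
Qed.

Let int1 x : \int[m2]_y fDE (x, y) = ((fun x => \int[m2]_(y in E) f (x, y)) \_ D) x.
Proof.
by rewrite fDE1 patchE; case: ifP => _; rewrite ?integral0// -integral_mkcond.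
Qed.

Let int2 y : \int[m1]_x fDE (x, y) = ((fun y => \int[m1]_(x in D) f (x, y)) \_ E) y.
Proof.
by rewrite fDE2 patchE; case: ifP => _; rewrite ?integral0// -integral_mkcond.
Qed.

Let mDE : measurable (D `*` E). Proof. exact: measurableX. Qed.

Let mfDE : measurable_fun setT fDE.
Proof. by apply/(measurable_restrictT _ mDE); exact: measurable_funTS. Qed.

Lemma measurable_integral_rectangle :
  measurable_fun setT (fun x => \int[m2]_(y in E) f (x, y)).
Proof.
under eq_fun do rewrite integral_mkcond integralE.
pose h := f \_ (setT `*` E).
have mh : measurable_fun setT h.
  apply/(measurable_restrictT _ (measurableX measurableT mE)).
  exact: measurable_funTS.
have hE x y : ((fun y => f (x, y)) \_ E) y = h (x, y).
  by rewrite /h !patchE in_setX in_setT.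
apply: emeasurable_funB.
  apply: eq_measurable_fun (measurable_fun_fubini_tonelli_F (m2 := m2) h^\+ _ _) => //.
    by move=> x _; apply: eq_integral => y _; rewrite !funeposE hE.
  exact: measurable_funepos.
apply: eq_measurable_fun (measurable_fun_fubini_tonelli_F (m2 := m2) h^\- _ _) => //.
  by move=> x _; apply: eq_integral => y _; rewrite !funenegE hE.
exact: measurable_funeneg.
Qed.

Lemma tonelli_rectangle : (forall x y, D x -> E y -> 0 <= f (x, y)) ->
  \int[m1]_(x in D) \int[m2]_(y in E) f (x, y) =
  \int[m2]_(y in E) \int[m1]_(x in D) f (x, y).
Proof.
move=> f0; have fDE0 z : 0 <= fDE z.
  by rewrite /fDE patchE; case: z => x y; case: ifP => // /set_mem[]; exact: f0.
rewrite integral_mkcond [RHS]integral_mkcond.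
have := fubini_tonelli (m1 := m1) (m2 := m2) fDE mfDE fDE0.
by rewrite (eq_integral _ _ (fun x _ => int1 x)) (eq_integral _ _ (fun y _ => int2 y)).
Qed.

Lemma integrable_rectangle :
  \int[m2]_(y in E) \int[m1]_(x in D) `|f (x, y)| < +oo ->
  (m1 \x m2).-integrable (D `*` E) f.
Proof.
move=> foo; apply/(integrable_mkcond _ mDE).
apply/(integrable21ltyP m1 m2 mfDE).
rewrite integral_mkcond in foo; rewrite (le_lt_trans _ foo)//.
rewrite le_eqVlt; apply/orP; left; apply/eqP; apply: eq_integral => y _.
rewrite patchE; case: ifPn => yE.
  rewrite [RHS]integral_mkcond; apply: eq_integral => x _.
  rewrite /fDE !patchE in_setX /= yE andbT; case: ifP => // _.
  by rewrite abse0.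
under eq_integral do rewrite /fDE patchE in_setX /= (negbTE yE) andbF abse0.
by rewrite integral0.
Qed.

Hypothesis fi : (m1 \x m2).-integrable (D `*` E) f.

Let fiDE : (m1 \x m2).-integrable setT fDE.
Proof. exact/(integrable_mkcond _ mDE). Qed.

Lemma fubini_rectangle :
  \int[m1]_(x in D) \int[m2]_(y in E) f (x, y) =
  \int[m2]_(y in E) \int[m1]_(x in D) f (x, y).
Proof.
rewrite integral_mkcond [RHS]integral_mkcond.
have := Fubini fiDE.
by rewrite (eq_integral _ _ (fun x _ => int1 x)) (eq_integral _ _ (fun y _ => int2 y)).
Qed.

Lemma integrable_fubini_rectangle :
  m1.-integrable D (fun x => \int[m2]_(y in E) f (x, y)).
Proof.
apply/(integrable_mkcond _ mD).
have := integrable_fubini_F fiDE; rewrite /fubini_F.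
by rewrite (funext int1).
Qed.

Lemma ae_integrable_rectangle :
  {ae m1, forall x, D x -> m2.-integrable E (fun y => f (x, y))}.
Proof.
have := ae_integrable1 fiDE; apply: filterS => x fx Dx.
apply/(integrable_mkcond _ mE).
by move: fx; rewrite fDE1 mem_set.
Qed.

End fubini_rectangle.

Section monotone.
Local Open Scope ereal_scope.
Context d (T : measurableType d) (R : realType).
Variable mu : {measure set T -> \bar R}.

Import HBNNSimple.

(** Monotonicity for arbitrary nonnegative functions, since their integral is
    the supremum over the simple functions below. It spares the measurability
    of inner integrals and of [V_minfty]. *)
Lemma le_ge0_integral (D : set T) (f1 f2 : T -> \bar R) :
  (forall x, D x -> 0 <= f1 x) -> (forall x, D x -> f1 x <= f2 x) ->
  \int[mu]_(x in D) f1 x <= \int[mu]_(x in D) f2 x.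
Proof.
move=> f10 f12; rewrite integral_mkcond [leRHS]integral_mkcond.
have h1 x : 0 <= (f1 \_ D) x.
  by rewrite patchE; case: ifP => // /set_mem; exact: f10.
have h12 x : (f1 \_ D) x <= (f2 \_ D) x.
  by rewrite !patchE; case: ifP => // /set_mem; exact: f12.
rewrite !ge0_integralTE//; last by move=> x; exact: le_trans (h12 x).
apply: ub_ereal_sup => _ [h /= hf <-]; apply: ereal_sup_ubound.
by exists h => //= x; exact: le_trans (hf x) (h12 x).
Qed.

Lemma integral_le_cst (D : set T) (f : T -> \bar R) (M : \bar R) :
  measurable D -> (forall x, D x -> 0 <= f x <= M) ->
  \int[mu]_(x in D) f x <= M * mu D.
Proof.
move=> mD fM; rewrite -integral_cst//; apply: le_ge0_integral => x Dx.
  by have /andP[] := fM x Dx.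
by have /andP[] := fM x Dx.
Qed.

End monotone.

(** * Square integrable functions *)
Section L2.
Context d (T : measurableType d) (R : realType) (mu : {measure set T -> \bar R}).

Lemma Lfun2_sqr (f : T -> R) : f \in Lfun mu 2%:E ->
  measurable_fun setT f /\ mu.-integrable setT (fun x => (f x ^+ 2)%:E).
Proof.
move=> Lf; have mf : measurable_fun setT f.
  by move: Lf; rewrite inE => /andP[]; rewrite inE.
split=> //; have := Lfun_integrable (ler1n R 2) Lf.
apply: eq_integrable => // x _ /=.
by rewrite -[2]/(2%:R) powR_mulrn// real_normK// num_real.
Qed.

Lemma sqr_Lfun2 (f : T -> R) : measurable_fun setT f ->
  mu.-integrable setT (fun x => (f x ^+ 2)%:E) -> f \in Lfun mu 2%:E.
Proof.
move=> mf fi; rewrite inE; apply/andP; split; rewrite inE//= /finite_norm.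
rewrite unlock /Lnorm /=.
apply: poweR_lty.
under eq_integral => x _ do
  rewrite -[2]/(2%:R) powR_mulrn// real_normK// ?num_real//.
have /integrableP[_] := fi; apply: le_lt_trans.
rewrite le_eqVlt; apply/orP; left; apply/eqP; apply: eq_integral => x _.
by rewrite /= ger0_norm// sqr_ge0.
Qed.

End L2.

(** * Compact supports and integrals over the unit interval *)
Section compact_support.
Context (R : realType) (N : nat).
Implicit Types (f phi : 'rV[R]_N -> R).

Lemma cube_le (K L : R) : K <= L -> cube N K `<=` cube N L.
Proof.
move=> KL x xK i; have := xK i; rewrite !in_itv/= => /andP[? ?].
by apply/andP; split; lra.
Qed.

Lemma continuous_bounded f (K : R) : continuous f ->
  (forall x, ~ cube N K x -> f x = 0) -> exists2 M, 0 < M & forall x, `|f x| <= M.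
Proof.
move=> cf f0; pose B := [set x : 'rV[R]_N | forall i, x 0 i \in `[- K, K]].
have cfB : compact (f @` B).
  apply: continuous_compact; last exact: compact_closed_cube.
  exact: continuous_subspaceT.
have [M [Mr /(_ (`|M| + 1))]] := compact_bounded cfB.
rewrite ltr_pwDr// ?ler_norm// => /(_ isT) h.
exists (`|M| + 1); first by rewrite ltr_pwDr// normr_ge0.
move=> x; have [xK|/f0 ->] := pselect (cube N K x); last first.
  by rewrite normr0 addr_ge0.
apply: h => /=; exists x => // i.
by have := xK i; rewrite !in_itv/= => /andP[/ltW -> /ltW ->].
Qed.

(** The cube is enlarged so that its complement has a neighbourhood on which
    [f] vanishes. *)
Lemma partial_out f (K : R) i : (forall x, ~ cube N K x -> f x = 0) ->
  forall x, ~ cube N (K + 1) x -> partial i f x = 0.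
Proof.
move=> f0 x /existsNP[j /negP xj].
rewrite /partial -(derive_cst (0 : R) x (delta_mx 0 i)).
apply: near_eq_derive; rewrite /cst /=.
near=> y; apply: f0 => /(_ j); rewrite in_itv/= => /andP[yK1 yK2].
have : `|x 0 j - y 0 j| < 1.
  near: y; have := @coord_continuous R 1 N 0 j x.
  by move=> /cvgrPdist_lt/(_ 1 ltr01).
rewrite ltr_distl => /andP[h1 h2].
move/negP: xj; apply; rewrite in_itv/=; apply/andP; split; lra.
Unshelve. all: by end_near.
Qed.

End compact_support.

Section unit_interval.
Context (R : realType).
Local Notation leb := (@lebesgue_measure R).

Lemma integrable_unit (h : R -> R) : continuous h ->
  leb.-integrable `]0%R, 1%R[ (EFin \o h).
Proof.
move=> ch; have h01 : leb.-integrable `[0%R, 1%R] (EFin \o h); last first.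
  by apply: integrableS h01 => //; exact: subset_itv_oo_cc.
apply: continuous_compact_integrable; first exact: segment_compact.
exact: continuous_subspaceT.
Qed.

(** The open interval is used, so that the weights [r^-1 ^+ m] are only
    evaluated at positive [r]. *)
Lemma integral_unit_derive (H h : R -> R) :
  (forall r : R, is_derive r 1 H (h r)) -> continuous h ->
  (\int[leb]_(r in `]0%R, 1%R[) (h r)%:E = (H 1 - H 0)%:E)%E.
Proof.
move=> dH ch.
have cH r : {for r, continuous H}.
  by apply: differentiable_continuous; apply/derivable1_diffP; have [] := dH r.
have mh : measurable_fun setT (EFin \o h).
  by apply/measurable_EFinP; exact: continuous_measurable_fun.
rewrite EFinB -(@continuous_FTC2 _ h H)//.
- by rewrite (@integral_itv_bndoo _ 0 1 (EFin \o h) true false)//; exact: measurable_funTS.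
- exact: continuous_subspaceT.
- split.
  + by move=> r _; have [] := dH r.
  + exact/cvg_at_right_filter/cH.
  + exact/cvg_at_left_filter/cH.
- by move=> r _; rewrite derive1E; have [_ ->] := dH r.
Qed.

Lemma integral_unit_expn n :
  (\int[leb]_(r in `]0%R, 1%R[) (r ^+ n)%:E = (n.+1%:R^-1)%:E)%E.
Proof.
have dH (r : R) : is_derive r 1 (fun r => n.+1%:R^-1 * r ^+ n.+1) (r ^+ n).
  rewrite (_ : (fun r => _) = (n.+1%:R^-1 : R) \*: ((@id R) ^+ n.+1)).
    by apply: is_derive_eq; rewrite /GRing.scale /= mulr1 mulKf// pnatr_eq0.
  by apply/funext => s; rewrite /= fctE.
rewrite (integral_unit_derive dH); last exact: exprn_continuous.
by rewrite expr1n expr0n mulr0 subr0 mulr1.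
Qed.

End unit_interval.

(** * The divergence form of the dilations about a pole *)
Section dilation.
Context (R : realType) (N : nat) (a : 'rV[R]_N).

Definition homothety (c : R) : 'rV[R]_N -> 'rV[R]_N := affine c (a - c *: a).

Lemma homothetyE c x i : homothety c x 0 i = a 0 i + c * (x 0 i - a 0 i).
Proof. by rewrite /homothety !mxE; ring. Qed.

Lemma homothetyK c x : c != 0 -> homothety c (homothety c^-1 x) = x.
Proof.
move=> c0; apply/rowP => i; rewrite !homothetyE; field; exact: c0.
Qed.

Lemma measurable_homothety (h : R -> R) : measurable_fun setT h ->
  measurable_fun setT (fun z : 'rV[R]_N * R => homothety (h z.2) z.1).
Proof.
move=> mh; apply: measurable_rv => i; under eq_fun do rewrite homothetyE.
have mx : measurable_fun setT (fun z : 'rV[R]_N * R => z.1 0 i).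
  exact: (measurableT_comp (measurable_coord i) measurable_fst).
apply: measurable_funD => //; apply: measurable_funM.
  exact: (measurableT_comp mh measurable_snd).
exact: measurable_funB.
Qed.

Let A : R := \sum_(i < N) `|a 0 i|.

Lemma homothety_cube K c x : 0 < c ->
  cube N K (homothety c x) -> cube N (A + (K + A) / c) x.
Proof.
move=> c0 h i; have := h i; rewrite homothetyE !in_itv/= => /andP[h1 h2].
have aA : `|a 0 i| <= A by rewrite /A (bigD1 i)//= lerDl sumr_ge0.
have := ler_norm (a 0 i); have := ler_norm (- a 0 i); rewrite normrN => a1 a2.
have {}h1 : - (K + A) / c < x 0 i - a 0 i by rewrite ltr_pdivrMr//; lra.
have {}h2 : x 0 i - a 0 i < (K + A) / c by rewrite ltr_pdivlMr//; lra.
by rewrite mulNr in h1; apply/andP; split; lra.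
Qed.

(** The vector field whose divergence is the derivative in [r] of
    [r ^+ (2 * N) * phi (homothety (r ^+ 2) x)]. *)
Definition dilation_field (phi : 'rV[R]_N -> R) (r : R) (i : 'I_N) (x : 'rV[R]_N) : R :=
  2 * r ^+ (2 * N).-1 * (x 0 i - a 0 i) * phi (homothety (r ^+ 2) x).

(** The common value of that divergence and of that derivative, see
    [div_dilation_field] and [is_derive_dilation]. *)
Definition dilation_div (phi : 'rV[R]_N -> R) (x : 'rV[R]_N) (r : R) : R :=
  2 * N%:R * r ^+ (2 * N).-1 * phi (homothety (r ^+ 2) x) +
  2 * r ^+ (2 * N).+1 *
    \sum_(i < N) (x 0 i - a 0 i) * partial i phi (homothety (r ^+ 2) x).

Lemma elementary_shift i : elementary (fun x : 'rV[R]_N => x 0 i - a 0 i).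
Proof. by apply: elementary_add; [exact: elementary_coord|exact: elementary_cst]. Qed.

Lemma elementary_dilation_field phi r i : elementary phi ->
  elementary (dilation_field phi r i).
Proof.
move=> nphi; apply: elementary_mul; last exact: elementary_affine.
by apply: elementary_mul; [exact: elementary_cst|exact: elementary_shift].
Qed.

Lemma partial_shift i (x : 'rV[R]_N) :
  partial i (fun x => x 0 i - a 0 i) x = 1.
Proof.
rewrite /partial deriveD//; last by apply: elementary_derivable; exact: elementary_coord.
rewrite derive_cst addr0 -[LHS]/(partial i (fun y : 'rV[R]_N => y 0 i) x).
by rewrite partial_coord eqxx.
Qed.

Lemma div_dilation_field phi r x : (0 < N)%N -> elementary phi ->
  \sum_(i < N) partial i (dilation_field phi r i) x = dilation_div phi x r.
Proof.
move=> N0 nphi.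
have nd := elementary_affine (r ^+ 2) (a - r ^+ 2 *: a) nphi.
have h i : partial i (dilation_field phi r i) x =
    2 * r ^+ (2 * N).-1 * phi (homothety (r ^+ 2) x) +
    2 * r ^+ (2 * N).+1 * ((x 0 i - a 0 i) * partial i phi (homothety (r ^+ 2) x)).
  rewrite /dilation_field /partial.
  have nl : elementary (fun x : 'rV[R]_N => 2 * r ^+ (2 * N).-1 * (x 0 i - a 0 i)).
    by apply: elementary_mul; [exact: elementary_cst|exact: elementary_shift].
  rewrite deriveM//; try exact: elementary_derivable.
  rewrite -!/(partial _ _ _) partial_affine; last exact: elementary_differentiable.
  rewrite {2}/partial deriveZ; last exact: elementary_derivable (elementary_shift _) _ _.
  rewrite -/(partial _ _ _) partial_shift /GRing.scale /= -/(homothety _).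
  have -> : (2 * N).+1 = ((2 * N).-1 + 2)%N by lia.
  by rewrite exprD; ring.
rewrite (eq_bigr _ (fun i _ => h i)) big_split /= sumr_const card_ord -mulr_sumr.
by rewrite /dilation_div -mulr_natr; ring.
Qed.

Lemma is_derive_homothety_sqr x (r : R) :
  is_derive r 1 (fun r : R => homothety (r ^+ 2) x) ((2 * r) *: (x - a)).
Proof.
have h (i : 'I_1) j : is_derive r 1 (fun r : R => homothety (r ^+ 2) x i j)
    (2 * r * (x 0 j - a 0 j)).
  rewrite ord1; under eq_fun do rewrite homothetyE.
  apply: is_derive_eq; rewrite /GRing.scale /=; ring.
split; first by apply/derivable_mxP => i j; have [] := h i j.
rewrite derive_mx; last by apply/derivable_mxP => i j; have [] := h i j.
apply/matrixP => i j; rewrite mxE; have [_ ->] := h i j.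
by rewrite ord1 !mxE.
Qed.

Lemma is_derive_dilation phi x (r : R) : elementary phi ->
  is_derive r 1 (fun r : R => r ^+ (2 * N) * phi (homothety (r ^+ 2) x))
    (dilation_div phi x r).
Proof.
move=> nphi; have [dc dcE] := is_derive_homothety_sqr x r.
have /derivable1_diffP dfc := dc.
have dphi := elementary_differentiable nphi (homothety (r ^+ 2) x).
have dpc : differentiable (phi \o (fun r : R => homothety (r ^+ 2) x)) r.
  exact: differentiable_comp.
have h : is_derive r 1 (fun r : R => phi (homothety (r ^+ 2) x))
    (2 * r * \sum_(i < N) (x 0 i - a 0 i) * partial i phi (homothety (r ^+ 2) x)).
  split; first exact/derivable1_diffP.
  rewrite -[fun _ => _]/(phi \o (fun r : R => homothety (r ^+ 2) x)) deriveE//.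
  rewrite (@diff_comp _ _ _ _ (fun r : R => homothety (r ^+ 2) x) phi)//=.
  rewrite -[X in 'd phi _ X]deriveE// dcE -deriveE// derive_sum_partial//.
  by rewrite mulr_sumr; apply: eq_bigr => i _; rewrite !mxE mulrA.
have hX : is_derive r 1 (fun r : R => r ^+ (2 * N)) ((2 * N)%:R * r ^+ (2 * N).-1).
  rewrite (_ : (fun r => _) = (@id R) ^+ (2 * N)); last first.
    by apply/funext => s; rewrite fctE.
  by apply: is_derive_eq; rewrite /GRing.scale /= mulr1.
apply: is_derive_eq (is_deriveM hX h) _.
by rewrite /dilation_div /GRing.scale /= !exprS natrM; ring.
Qed.

Lemma continuous_dilation_div phi x : elementary phi -> continuous (dilation_div phi x).
Proof.
move=> nphi.
have cX k : continuous (fun r : R => r ^+ k) by exact: exprn_continuous.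
have cd : continuous (fun r : R => homothety (r ^+ 2) x).
  move=> r; apply: differentiable_continuous; apply/derivable1_diffP.
  by have [] := is_derive_homothety_sqr x r.
have cc f : elementary f -> continuous (fun r : R => f (homothety (r ^+ 2) x)).
  move=> nf r; apply: (@continuous_comp _ _ _ (fun r : R => homothety (r ^+ 2) x) f).
    exact: cd.
  exact: elementary_continuous.
move=> r; apply: cvgD.
  by apply: cvgM; [apply: cvgM; [exact: cvg_cst|exact: cX]|exact: cc].
apply: cvgM; first by apply: cvgM; [exact: cvg_cst|exact: cX].
elim: (index_enum _) => [|i s IH].
  by under eq_fun do rewrite big_nil; rewrite big_nil; exact: cvg_cst.
under eq_fun do rewrite big_cons; rewrite big_cons; apply: cvgD => //.
by apply: cvgM; [exact: cvg_cst|apply: cc; exact: elementary_partial].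
Qed.

(** At [r = 1] the primitive [r ^+ (2 * N) * phi (homothety (r ^+ 2) x)] is
    [phi x], and it vanishes at [r = 0]. *)
Lemma integral_dilation_div phi x : (0 < N)%N -> elementary phi ->
  (\int[lebesgue_measure]_(r in `]0%R, 1%R[) (dilation_div phi x r)%:E = (phi x)%:E)%E.
Proof.
move=> N0 nphi.
rewrite (integral_unit_derive (fun r => is_derive_dilation x r nphi)); last first.
  exact: continuous_dilation_div.
rewrite expr1n mul1r expr0n muln_eq0 /= eqn0Ngt N0 mul0r subr0.
suff -> : homothety (1 ^+ 2) x = x by [].
by apply/rowP => i; rewrite homothetyE expr1n mul1r addrC subrK.
Qed.

End dilation.

(** * Inequalities and integrability against test functions *)

(** The expansion of [\sum_i (B u_i - C v_i) ^+ 2 >= 0], where [B] and [C] are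
    the sum of the [v_i ^+ 2] and the sum of the [u_i * v_i]. *)
Lemma sum_cauchy_schwarz (R : realFieldType) (I : finType) (u v : I -> R) :
  (\sum_i u i * v i) ^+ 2 <= (\sum_i u i ^+ 2) * (\sum_i v i ^+ 2).
Proof.
set A := \sum_i u i ^+ 2; set B := \sum_i v i ^+ 2; set C := \sum_i u i * v i.
have B0 : 0 <= B by apply: sumr_ge0 => i _; exact: sqr_ge0.
have h : 0 <= B * (A * B - C ^+ 2).
  have -> : B * (A * B - C ^+ 2) = \sum_i (B * u i - C * v i) ^+ 2.
    rewrite (eq_bigr (fun i => B ^+ 2 * u i ^+ 2 - (2 * B * C) * (u i * v i) +
      C ^+ 2 * v i ^+ 2)); last by move=> i _; ring.
    rewrite big_split sumrB -!mulr_sumr -/A -/B -/C /=; ring.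
  by apply: sumr_ge0 => i _; exact: sqr_ge0.
have [B1|] := boolP (0 < B).
  by move: h; rewrite pmulr_rge0// subr_ge0.
rewrite lt0r B0 andbT negbK => /eqP B1.
have v0 i : v i = 0.
  apply/eqP; rewrite -sqrf_eq0; apply/eqP.
  have /eqP := B1; rewrite psumr_eq0 => [/allP/(_ i)|j _]; last exact: sqr_ge0.
  by rewrite mem_index_enum => /(_ isT) /eqP.
have -> : C = 0 by rewrite /C big1// => i _; rewrite v0 mulr0.
by rewrite B1 mulr0 expr0n.
Qed.

Lemma ler_norm_amgm (R : realFieldType) (x b c : R) :
  0 <= b -> 0 <= c -> x ^+ 2 <= b * c -> 2 * `|x| <= b + c.
Proof.
move=> b0 c0 xbc; rewrite -ler_sqr ?nnegrE ?addr_ge0 ?mulr_ge0//.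
rewrite exprMn real_normK ?num_real//; have := sqr_ge0 (b - c); nra.
Qed.

Lemma integrable_cube1 (R : realType) (N : nat) (K : R) :
  (vol R N).-integrable (cube N K) (cst 1%E).
Proof.
have mc := @measurable_cube R N K; apply/integrableP; split => //.
rewrite (eq_integral (cst 1%E)); last by move=> x _; rewrite /= normr1.
by rewrite integral_cst// mul1e vol_cube_lty.
Qed.

Lemma enorm_sqr (R : realType) (N : nat) (x : 'rV[R]_N) :
  enorm x ^+ 2 = \sum_i x 0 i ^+ 2.
Proof. by rewrite sqr_sqrtr// sumr_ge0// => i _; exact: sqr_ge0. Qed.

Lemma measurable_inve_EFin d (T : measurableType d) (R : realType) (f : T -> R) :
  measurable_fun setT f -> measurable_fun setT (fun x => ((f x)%:E^-1)%E).
Proof.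
move=> mf; under eq_fun do rewrite inver.
apply: measurable_fun_ifT.
- exact: measurable_fun_eqr.
- exact: measurable_cst.
- by apply/measurable_EFinP; exact: (measurableT_comp (@measurable_invr R) mf).
Qed.

Lemma integrable_cube_sqr (R : realType) (N : nat) (f : 'rV[R]_N -> R) (K : R) :
  measurable_fun setT f ->
  (vol R N).-integrable setT (fun x => (f x ^+ 2)%:E) ->
  (vol R N).-integrable (cube N K) (EFin \o f).
Proof.
move=> mf fi; have mc := @measurable_cube R N K.
have fiK : (vol R N).-integrable (cube N K) (fun x => (f x ^+ 2)%:E).
  exact: integrableS fi.
apply: le_integrable (integrableD mc (integrable_cube1 N K) fiK) => //.
  by apply/measurable_EFinP; exact: measurable_funTS.
move=> x _; rewrite /= lee_fin [leRHS]ger0_norm ?addr_ge0 ?sqr_ge0//.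
rewrite -[f x ^+ 2]real_normK ?num_real//; have := sqr_ge0 (`|f x| - 1).
have := normr_ge0 (f x); nra.
Qed.

Lemma integrable_mul_elementary (R : realType) (N : nat) (f phi : 'rV[R]_N -> R) (K : R) :
  measurable_fun setT f -> (vol R N).-integrable (cube N K) (EFin \o f) ->
  elementary phi -> (forall x, ~ cube N K x -> phi x = 0) ->
  (vol R N).-integrable setT (fun x => (f x * phi x)%:E).
Proof.
move=> mf fi nphi phi0; have cphi := elementary_continuous nphi.
have [M M0 phiM] := continuous_bounded cphi phi0.
apply: (integrable_mul_cube (K := K) (M := M)) => //.
exact: continuous_measurable_rv.
Qed.

(* [weak_partial] is stated with [lebesgue_rv], to which [vol] unfolds. *)
Transparent vol.

Lemma weak_partial_elementary (R : realType) (N : nat) (i : 'I_N)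
    (f f' phi : 'rV[R]_N -> R) (K : R) :
  measurable_fun setT f -> (forall K, (vol R N).-integrable (cube N K) (EFin \o f)) ->
  measurable_fun setT f' -> (forall K, (vol R N).-integrable (cube N K) (EFin \o f')) ->
  weak_partial i f f' -> elementary phi -> (forall x, ~ cube N K x -> phi x = 0) ->
  (\int[vol R N]_x (f x * partial i phi x)%:E =
   - \int[vol R N]_x (f' x * phi x)%:E)%E.
Proof.
move=> mf fi mf' fi' wf nphi phi0.
have i1 : (vol R N).-integrable setT (fun x => (f x * partial i phi x)%:E).
  apply: (@integrable_mul_elementary _ _ _ _ (K + 1)) => //.
    exact: elementary_partial.
  exact: partial_out.
have i2 : (vol R N).-integrable setT (fun x => (f' x * phi x)%:E).
  exact: (@integrable_mul_elementary _ _ _ _ K).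
have h : Rintegral (vol R N) setT (fun x => f x * partial i phi x) =
    - Rintegral (vol R N) setT (fun x => f' x * phi x).
  exact: wf (test_elementary nphi phi0).
rewrite -(fineK (integrable_fin_num measurableT i1)).
rewrite -(fineK (integrable_fin_num measurableT i2)) -EFinN.
by congr EFin.
Qed.

Opaque vol.

(** * The Hardy inequality with one pole *)
Section hardy.
Context (R : realType) (N : nat) (hN : (3 <= N)%N).
Context (a : 'rV[R]_N) (p : 'rV[R]_N -> R) (g : 'I_N -> 'rV[R]_N -> R).
Local Notation mu := (vol R N).
Local Notation leb := (@lebesgue_measure R).
Local Notation I := (`]0%R, 1%R[%classic : set R).

Let gsq x := \sum_i g i x ^+ 2.
Let nsq (y : 'rV[R]_N) := \sum_i (y 0 i - a 0 i) ^+ 2.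

Hypotheses (mp : measurable_fun setT p) (mg : forall i, measurable_fun setT (g i)).
Hypothesis ip : mu.-integrable setT (fun x => (p x ^+ 2)%:E).
Hypothesis ig : forall i, mu.-integrable setT (fun x => (g i x ^+ 2)%:E).
Hypothesis weak_pg : forall i, weak_partial i p (g i).

(* The integrand [ray y] is proportional to this weight for the extremal
   profile [|y - a| ^ (- (N - 2) / 2)], so no constant is lost in the weighted
   Cauchy-Schwarz inequality [pointwise]. *)
Let weight (r : R) : R := r ^+ (N - 3).
Let ray_energy (y : 'rV[R]_N) (r : R) : R :=
  4 * r^-1 ^+ (N + 3) * gsq (homothety a (r^-1 ^+ 2) y).
(* Integrated over [0 < r < 1], this is the integral of [g . dx] along the ray
   from [y] to infinity, parametrized by [a + r^-2 (y - a)]. *)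
Let ray (y : 'rV[R]_N) (r : R) : R :=
  2 * r^-1 ^+ 3 * \sum_i g i (homothety a (r^-1 ^+ 2) y) * (y 0 i - a 0 i).

Let energy : R := fine (\int[mu]_x (gsq x)%:E).

Let igsq : mu.-integrable setT (fun x => (gsq x)%:E).
Proof.
have := @integrable_sum _ _ _ mu setT measurableT _ (index_enum 'I_N) xpredT
  (fun i x => (g i x ^+ 2)%:E) (fun i _ => ig i).
by apply: eq_integrable => // x _; rewrite /gsq sumEFin.
Qed.

Let energyE : (\int[mu]_x (gsq x)%:E = energy%:E)%E.
Proof. by rewrite fineK//; exact: integrable_fin_num. Qed.

Let gsq_ge0 x : 0 <= gsq x.
Proof. by apply: sumr_ge0 => i _; exact: sqr_ge0. Qed.

Let nsq_ge0 x : 0 <= nsq x.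
Proof. by apply: sumr_ge0 => i _; exact: sqr_ge0. Qed.

Let mgsq : measurable_fun setT gsq.
Proof. by apply: measurable_sum => i; exact: measurable_funX. Qed.

Let weight_ge0 r : I r -> 0 <= weight r.
Proof. by rewrite /= in_itv/= => /andP[/ltW r0 _]; exact: exprn_ge0. Qed.

Let weight_le1 r : I r -> weight r <= 1.
Proof. by rewrite /= in_itv/= => /andP[/ltW ? /ltW ?]; exact: exprn_ile1. Qed.

Let ray_energy_ge0 y r : I r -> 0 <= ray_energy y r.
Proof.
rewrite /= in_itv/= => /andP[/ltW r0 _].
by rewrite !mulr_ge0 ?exprn_ge0 ?invr_ge0.
Qed.

Let ray_sqr y r : I r -> ray y r ^+ 2 <= nsq y * (weight r * ray_energy y r).
Proof.
rewrite /= in_itv/= => /andP[r0 _].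
rewrite /ray exprMn.
have -> : nsq y * (weight r * ray_energy y r) =
    (2 * r^-1 ^+ 3) ^+ 2 * (gsq (homothety a (r^-1 ^+ 2) y) * nsq y).
  have -> : weight r * ray_energy y r =
      4 * (r^-1 ^+ 3) ^+ 2 * gsq (homothety a (r^-1 ^+ 2) y).
    rewrite /weight /ray_energy; have -> : (N + 3 = (N - 3) + 3 * 2)%N by lia.
    rewrite exprD (exprM _ 3 2) exprVn; field.
    by rewrite expf_neq0// gt_eqF.
  by ring.
rewrite ler_pM2l ?exprn_gt0 ?mulr_gt0 ?exprn_gt0 ?invr_gt0//.
exact: sum_cauchy_schwarz.
Qed.

Let mray_energy : measurable_fun setT (fun z : 'rV[R]_N * R => ray_energy z.1 z.2).
Proof.
have mV n : measurable_fun setT (fun z : 'rV[R]_N * R => z.2^-1 ^+ n).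
  apply: measurable_funX.
  exact: (measurableT_comp (@measurable_invr R) measurable_snd).
apply: measurable_funM; first exact: measurable_funM.
apply: (measurableT_comp mgsq); apply: (@measurable_homothety _ _ a (fun r => r^-1 ^+ 2)).
by apply: measurable_funX; exact: measurable_invr.
Qed.

Let mray : measurable_fun setT (fun z : 'rV[R]_N * R => ray z.1 z.2).
Proof.
have mV n : measurable_fun setT (fun z : 'rV[R]_N * R => z.2^-1 ^+ n).
  apply: measurable_funX.
  exact: (measurableT_comp (@measurable_invr R) measurable_snd).
apply: measurable_funM; first exact: measurable_funM.
apply: measurable_sum => i; apply: measurable_funM.
  apply: (measurableT_comp (mg i)).
  apply: (@measurable_homothety _ _ a (fun r => r^-1 ^+ 2)).
  by apply: measurable_funX; exact: measurable_invr.
apply: measurable_funB => //.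
exact: (measurableT_comp (measurable_coord i) measurable_fst).
Qed.

(** The change of variables gives [r ^+ (2 * N)], which turns the factor
    [r^-1 ^+ (N + 3)] of [ray_energy] into the weight [r ^+ (N - 3)]. *)
Let int_ray_energy r : I r ->
  (\int[mu]_y (ray_energy y r)%:E = (4 * weight r * energy)%:E)%E.
Proof.
rewrite /= in_itv/= => /andP[r0 _]; have rV : 0 < r^-1 by rewrite invr_gt0.
under eq_integral do rewrite /ray_energy EFinM.
rewrite ge0_integralZl//; last 3 first.
- by apply/measurable_EFinP; apply: (measurableT_comp mgsq); exact: measurable_affine.
- by move=> y _; rewrite lee_fin.
- by rewrite lee_fin mulr_ge0// exprn_ge0// ltW.
rewrite (@ge0_integral_affine _ _ _ _ (fun x => (gsq x)%:E)) ?exprn_gt0//;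
  last exact/measurable_EFinP.
rewrite energyE -!EFinM; congr EFin; rewrite /weight.
have -> : ((r^-1 ^+ 2)^-1 ^+ N) = r ^+ (N - 3) * r ^+ (N + 3).
  rewrite -exprVn invrK -exprM -exprD; congr (_ ^+ _); lia.
rewrite exprVn; field; rewrite expf_neq0// gt_eqF//.
Qed.

Let int_int_ray_energy :
  (\int[leb]_(r in I) \int[mu]_y (ray_energy y r)%:E =
   (4 / (N - 2)%:R * energy)%:E)%E.
Proof.
have -> : (\int[leb]_(r in I) \int[mu]_y (ray_energy y r)%:E =
    \int[leb]_(r in I) ((4 * energy)%:E * (r ^+ (N - 3))%:E))%E.
  apply: eq_integral => r /set_mem rI; rewrite int_ray_energy// -EFinM; congr EFin.
  by rewrite /weight; ring.
rewrite integralZl//; last exact: integrable_unit (@exprn_continuous _ _).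
rewrite integral_unit_expn -EFinM; congr EFin.
have -> : (N - 3).+1 = (N - 2)%N by lia.
by ring.
Qed.

Let lebI : leb I = 1%E.
Proof. by rewrite lebesgue_measure_itv /= lte_fin ltr01 oppr0 adde0. Qed.

Let nsq_bounded (K : R) : exists2 B, 0 <= B & forall y, cube N K y -> nsq y <= B.
Proof.
exists (\sum_i (K + `|a 0 i|) ^+ 2).
  by apply: sumr_ge0 => i _; exact: sqr_ge0.
move=> y yK; apply: ler_sum => i _.
have := yK i; rewrite in_itv/= => /andP[h1 h2].
have := ler_norm (a 0 i); have := ler_norm (- a 0 i); rewrite normrN => a1 a2.
have s1 : 0 <= K + `|a 0 i| - (y 0 i - a 0 i) by lra.
have s2 : 0 <= K + `|a 0 i| + (y 0 i - a 0 i) by lra.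
by have := mulr_ge0 s1 s2; rewrite -subr_sqr subr_ge0.
Qed.

(** [2 |ray| <= weight + nsq * ray_energy], where the weight is at most 1 and
    [nsq] is bounded on the cube, while [ray_energy] has bounded integral. *)
Let iray (K : R) : (mu \x leb)%E.-integrable (cube N K `*` I)
  (fun z => (ray z.1 z.2)%:E).
Proof.
have mc := @measurable_cube R N K; have mI : measurable I by [].
apply: integrable_rectangle => //; first exact/measurable_EFinP.
have [B B0 nB] := nsq_bounded K.
have S0 : 0 <= energy.
  by rewrite -lee_fin -energyE; apply: integral_ge0 => x _; rewrite lee_fin.
have V0 : vol R N (cube N K) \is a fin_num by rewrite ge0_fin_numE ?vol_cube_lty.
set V := fine (vol R N (cube N K)).
apply: le_lt_trans (_ : ((V + B * (4 * energy))%:E * leb I < +oo)%E); last first.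
  by rewrite lebI mule1 ltry.
apply: integral_le_cst => // r rI; apply/andP; split; first exact: integral_ge0.
have -> : ((V + B * (4 * energy))%:E =
    \int[mu]_(y in cube N K) 1%:E + B%:E * (4 * energy)%:E)%E.
  by rewrite integral_cst// mul1e EFinD EFinM fineK.
have kmeas : measurable_fun (cube N K) (fun y => (ray_energy y r)%:E).
  apply/measurable_EFinP; apply: measurable_funTS.
  exact: (measurableT_comp mray_energy (pair2_measurable r)).
apply: (@le_trans _ _ (\int[mu]_(y in cube N K) (1%:E + B%:E * (ray_energy y r)%:E))%E).
  apply: le_ge0_integral => // y yK; rewrite -EFinM -EFinD lee_fin.
  have := @ler_norm_amgm _ (ray y r) (weight r) (B * ray_energy y r) (weight_ge0 rI).
  rewrite mulr_ge0// ?ray_energy_ge0// => /(_ isT); have := normr_ge0 (ray y r).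
  have := weight_le1 rI => w1 F0 h.
  have {}h : 2 * `|ray y r| <= weight r + B * ray_energy y r.
    apply: h; apply: le_trans (ray_sqr y rI) _.
    rewrite mulrCA ler_wpM2l ?weight_ge0// ler_wpM2r ?ray_energy_ge0//; exact: nB.
  by lra.
rewrite ge0_integralD//; last 2 first.
- by move=> y _; rewrite -EFinM lee_fin mulr_ge0// ray_energy_ge0.
- exact: measurable_funeM.
rewrite leeD2l// ge0_integralZl//; last by move=> y _; rewrite lee_fin ray_energy_ge0.
rewrite lee_wpmul2l ?lee_fin//.
apply: (@le_trans _ _ (\int[mu]_y (ray_energy y r)%:E)%E).
  apply: ge0_subset_integral => //.
    apply/measurable_EFinP.
    exact: (measurableT_comp mray_energy (pair2_measurable r)).
  by move=> y _; rewrite lee_fin ray_energy_ge0.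
rewrite int_ray_energy// lee_fin; have := weight_le1 rI => w1; have := weight_ge0 rI => w0.
rewrite -mulrA ler_wpM2l// ler_piMl//.
Qed.

Let p_cube (K : R) : mu.-integrable (cube N K) (EFin \o p).
Proof. exact: integrable_cube_sqr. Qed.

Let g_cube i (K : R) : mu.-integrable (cube N K) (EFin \o g i).
Proof. exact: integrable_cube_sqr. Qed.

(** The weak derivatives are tested on the field [dilation_field], and the
    variable [x] is replaced by [homothety a (r^-1 ^+ 2) y]. *)
Let weak_dilated phi (K r : R) : I r -> elementary phi ->
  (forall x, ~ cube N K x -> phi x = 0) ->
  (\int[mu]_x (p x * dilation_div a phi x r)%:E = \int[mu]_y (- (ray y r * phi y))%:E)%E.
Proof.
move=> rI nphi phi0; have := rI; rewrite /= in_itv/= => /andP[r0 _].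
have r20 : 0 < r ^+ 2 by rewrite exprn_gt0.
pose L := \sum_(i < N) `|a 0 i| + (K + \sum_(i < N) `|a 0 i|) / r ^+ 2.
have field0 i x : ~ cube N L x -> dilation_field a phi r i x = 0.
  by move=> xL; rewrite /dilation_field phi0 ?mulr0// => /(homothety_cube r20).
have elem_field i := elementary_dilation_field a r i nphi.
have i_div i : mu.-integrable setT
    (fun x => (p x * partial i (dilation_field a phi r i) x)%:E).
  apply: (@integrable_mul_elementary _ _ p _ (L + 1)) => //.
    exact: elementary_partial.
  by apply: partial_out; exact: field0.
have igc i : mu.-integrable setT (fun x => (g i x * dilation_field a phi r i x)%:E).
  by apply: (@integrable_mul_elementary _ _ (g i) _ L) => //; exact: field0.
transitivity (\int[mu]_x \sum_i (p x * partial i (dilation_field a phi r i) x)%:E)%E.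
  apply: eq_integral => x _; rewrite sumEFin -mulr_sumr div_dilation_field//.
  by lia.
rewrite integral_sum//; under eq_bigr => i _ do
  rewrite (weak_partial_elementary mp p_cube (mg i) (g_cube i) (weak_pg i)
    (elem_field i) (field0 i)).
have igN i : mu.-integrable setT (fun x => (- (g i x * dilation_field a phi r i x))%:E).
  exact: integrableN (igc i).
transitivity (\int[mu]_x \sum_i (- (g i x * dilation_field a phi r i x))%:E)%E.
  rewrite integral_sum//; apply: eq_bigr => i _.
  rewrite -integralN; first by apply: eq_integral => x _; rewrite EFinN.
  by rewrite fin_num_adde_defl// fin_numN; exact: integrable_neg_fin_num.
pose H x := (\sum_i - (g i x * dilation_field a phi r i x))%:E.
have iH : mu.-integrable setT H.
  apply: eq_integrable (integrable_sum measurableT _ (fun i _ => igN i)) => // x _.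
  by rewrite sumEFin.
transitivity (\int[mu]_x H x)%E; first by apply: eq_integral => x _; rewrite sumEFin.
have rn0 : r != 0 by rewrite gt_eqF.
have rV0 : 0 < r^-1 ^+ 2 by rewrite exprn_gt0// invr_gt0.
pose c : R := (r^-1 ^+ 2) ^+ N.
transitivity (\int[mu]_y (c%:E * H (homothety a (r^-1 ^+ 2) y)))%E.
  rewrite (@integral_affine R N _ _ (fun x => c%:E * H x)%E)//; last exact: integrableZl.
  rewrite integralZl// muleA -EFinM -exprMn mulVf ?gt_eqF// expr1n mul1e//.
apply: eq_integral => y _; rewrite /H -EFinM; congr EFin.
rewrite sumrN mulrN; congr (- _).
rewrite /ray mulrAC !mulr_sumr; apply: eq_bigr => i _.
rewrite /dilation_field exprVn homothetyK ?expf_neq0// -exprVn homothetyE /c.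
have -> : (2 * N).-1 = (2 * N - 1)%N by lia.
have -> : ((r^-1 ^+ 2) ^+ N) = r^-1 * r^-1 ^+ (2 * N - 1).
  rewrite -exprM -exprS; congr (_ ^+ _); lia.
rewrite exprVn; field; rewrite rn0 expf_neq0//.
Qed.

(** In [dilation_div], [r ^+ 2 * (x - a)] is the difference of
    [homothety a (r ^+ 2) x] and [a]; it is bounded on the support of [phi],
    although [x] itself is not bounded as [r] tends to 0. *)
Let dilation_div_bound phi (K : R) : elementary phi ->
  (forall x, ~ cube N K x -> phi x = 0) -> exists2 C, 0 <= C & forall x r, I r ->
  `|dilation_div a phi x r| <=
    C * (r ^+ (2 * N).-1 * \1_(cube N (K + 1)) (homothety a (r ^+ 2) x)).
Proof.
move=> nphi phi0.
have [M M0 phiM] := continuous_bounded (elementary_continuous nphi) phi0.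
have hM i : exists2 M, 0 < M & forall x, `|partial i phi x| <= M.
  apply: (@continuous_bounded _ _ _ (K + 1)).
    exact/elementary_continuous/elementary_partial.
  exact: partial_out.
pose M1 i := sval (cid2 (hM i)).
have M1P i x : `|partial i phi x| <= M1 i by rewrite /M1; case: cid2.
pose B := `|K + 1| + \sum_(i < N) `|a 0 i|.
have M1_ge0 i : 0 <= M1 i by apply: le_trans (M1P i 0).
have B0 : 0 <= B by rewrite addr_ge0// sumr_ge0.
exists (2 * N%:R * M + 2 * (B * \sum_i M1 i)).
  by rewrite addr_ge0 ?mulr_ge0 ?sumr_ge0// ltW.
move=> x r; rewrite /= in_itv/= => /andP[r0 _].
rewrite indicE.
case: (boolP (homothety a (r ^+ 2) x \in cube N (K + 1))) => [xK|]; last first.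
  move=> /negP xK; have {}xK : ~ cube N (K + 1) (homothety a (r ^+ 2) x).
    by move=> h; apply: xK; rewrite inE.
  rewrite !mulr0 /dilation_div phi0; last first.
    by move=> h; apply: xK; apply: cube_le h; rewrite lerDl.
  rewrite big1; first by rewrite !mulr0 addr0 normr0.
  by move=> i _; rewrite (partial_out (K := K))// mulr0.
move/set_mem in xK; rewrite mulr1 /dilation_div.
have -> : (2 * N).+1 = ((2 * N).-1 + 2)%N by lia.
rewrite exprD [leRHS]mulrDl; apply: le_trans (ler_normD _ _) _.
have rn : 0 <= r ^+ (2 * N).-1 by rewrite exprn_ge0// ltW.
apply: lerD.
  by rewrite normrM ger0_norm ?mulr_ge0// mulrAC ler_wpM2r// ler_wpM2l ?mulr_ge0.
have -> : 2 * (r ^+ (2 * N).-1 * r ^+ 2) *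
    (\sum_(i < N) (x 0 i - a 0 i) * partial i phi (homothety a (r ^+ 2) x)) =
    2 * r ^+ (2 * N).-1 *
    (\sum_(i < N) (r ^+ 2 * (x 0 i - a 0 i)) * partial i phi (homothety a (r ^+ 2) x)).
  rewrite -[RHS]mulrA -[LHS]mulrA -[X in _ * X = _]mulrA mulr_sumr.
  by do 2 congr (_ * _); apply: eq_bigr => i _; rewrite mulrA.
rewrite normrM ger0_norm ?mulr_ge0// [leRHS]mulrAC ler_wpM2l ?mulr_ge0//.
rewrite mulr_sumr; apply: le_trans (ler_norm_sum _ _ _) _.
apply: ler_sum => i _; rewrite normrM; apply: ler_pM => //.
have := xK i; rewrite homothetyE in_itv/= => /andP[h1 h2].
have aA : `|a 0 i| <= \sum_(i < N) `|a 0 i|.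
  by rewrite (bigD1 i)//= lerDl sumr_ge0.
have := ler_norm (a 0 i); have := ler_norm (- a 0 i); rewrite normrN => a1 a2.
have := ler_norm (K + 1) => K1.
by rewrite /B ler_norml; apply/andP; split; lra.
Qed.

(** With [2 |p| b <= p ^+ 2 + b ^+ 2] for [b = r ^+ (2 * N).-1], the dilated
    cube has volume of order [r^-1 ^+ (2 * N)], which [b ^+ 2] compensates. *)
Let i_pdiv phi (K : R) : elementary phi -> (forall x, ~ cube N K x -> phi x = 0) ->
  (mu \x leb)%E.-integrable (setT `*` I)
    (fun z => (p z.1 * dilation_div a phi z.1 z.2)%:E).
Proof.
move=> nphi phi0; have mI : measurable I by [].
have melem f : elementary f ->
    measurable_fun setT (fun z : 'rV[R]_N * R => f (homothety a (z.2 ^+ 2) z.1)).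
  move=> nf; have cf := elementary_continuous nf.
  apply: (measurableT_comp (continuous_measurable_rv cf)).
  exact: (@measurable_homothety _ _ a (fun r => r ^+ 2)).
have m2 : measurable_fun setT (fun z : 'rV[R]_N * R => z.2) by exact: measurable_snd.
have m1 i : measurable_fun setT (fun z : 'rV[R]_N * R => z.1 0 i).
  exact: (measurableT_comp (measurable_coord i) measurable_fst).
apply: integrable_rectangle => //.
  apply/measurable_EFinP; apply: measurable_funM.
    exact: (measurableT_comp mp measurable_fst).
  apply: measurable_funD; apply: measurable_funM.
  - by apply: measurable_funM => //; exact: measurable_funX.
  - exact: melem.
  - by apply: measurable_funM => //; exact: measurable_funX.
  - apply: measurable_sum => i; apply: measurable_funM.
      exact: (measurable_funB (m1 i) (measurable_cst _)).
    by apply: melem; exact: elementary_partial.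
have [C C0 divC] := dilation_div_bound nphi phi0.
have mc := @measurable_cube R N (K + 1).
have V0 : vol R N (cube N (K + 1)) \is a fin_num by rewrite ge0_fin_numE ?vol_cube_lty.
set V := fine (vol R N (cube N (K + 1))).
have P0 : (\int[mu]_x (p x ^+ 2)%:E \is a fin_num)%E by exact: integrable_fin_num.
set P := fine (\int[mu]_x (p x ^+ 2)%:E).
apply: le_lt_trans (_ : ((C * (P + V))%:E * leb I < +oo)%E); last first.
  by rewrite lebI mule1 ltry.
apply: integral_le_cst => // r rI; apply/andP; split; first exact: integral_ge0.
have := rI; rewrite /= in_itv/= => /andP[r0 r1].
have mind : measurable_fun setT
    (fun x => (\1_(cube N (K + 1)) (homothety a (r ^+ 2) x) : R)%:E).
  apply/measurable_EFinP; apply: (measurableT_comp _ (measurable_affine _ _)).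
  exact: measurable_indic.
pose b : R := r ^+ (2 * N).-1.
apply: (@le_trans _ _ (\int[mu]_x (C%:E *
    ((p x ^+ 2)%:E +
     (b ^+ 2)%:E * (\1_(cube N (K + 1)) (homothety a (r ^+ 2) x))%:E)))%E).
  apply: le_ge0_integral => // x _; rewrite -!EFinM lee_fin normrM.
  apply: le_trans (ler_wpM2l (normr_ge0 _) (divC x r rI)) _.
  rewrite mulrCA ler_wpM2l// -/b.
  have : \1_(cube N (K + 1)) (homothety a (r ^+ 2) x) = 0 :> R \/
      \1_(cube N (K + 1)) (homothety a (r ^+ 2) x) = 1 :> R.
    by rewrite indicE; case: (_ \in _); [right|left].
  rewrite -[p x ^+ 2]real_normK ?num_real//; set q := `|p x|.
  have q0 : 0 <= q by exact: normr_ge0.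
  move=> [->|->]; first by rewrite !mulr0 addr0 sqr_ge0.
  rewrite !mulr1; have := sqr_ge0 (q - b); have := sqr_ge0 q; have := sqr_ge0 b; nra.
have mp2 : measurable_fun setT (fun x => (p x ^+ 2)%:E).
  by apply/measurable_EFinP; exact: measurable_funX.
rewrite ge0_integralZl//; last 2 first.
- by apply: emeasurable_funD => //; exact: measurable_funeM.
- move=> x _; rewrite -?EFinM -?EFinD lee_fin; apply: addr_ge0; first exact: sqr_ge0.
  by apply: mulr_ge0; [exact: sqr_ge0|rewrite indicE ler0n].
rewrite [leRHS]EFinM lee_wpmul2l ?lee_fin//.
rewrite ge0_integralD//; last 3 first.
- by move=> x _; rewrite lee_fin sqr_ge0.
- by move=> x _; rewrite mule_ge0 ?lee_fin ?sqr_ge0.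
- exact: measurable_funeM.
rewrite EFinD fineK// leeD2l// ge0_integralZl//; last by rewrite lee_fin sqr_ge0.
rewrite (@ge0_integral_affine _ _ _ _ (fun x => (\1_(cube N (K + 1)) x)%:E))
  ?exprn_gt0//; last first.
  by apply/measurable_EFinP; exact: measurable_indic.
rewrite integral_indic// setIT (_ : _ (cube N (K + 1)) = V%:E); last by rewrite fineK.
rewrite -!EFinM lee_fin mulrA ler_piMl//.
  by rewrite fine_ge0.
have -> : b ^+ 2 * (r ^+ 2)^-1 ^+ N = r ^+ (2 * N - 2).
  rewrite /b exprVn -!exprM.
  have -> : ((2 * N).-1 * 2 = (2 * N - 2) + 2 * N)%N by lia.
  by rewrite exprD mulfK// expf_neq0// gt_eqF.
by rewrite exprn_ile1// ltW.
Qed.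

Let ray_integral y := (\int[leb]_(r in I) (ray y r)%:E)%E.

Let mray_integral : measurable_fun setT ray_integral.
Proof.
apply: (@measurable_integral_rectangle _ _ _ _ R leb I _
  (fun z : 'rV[R]_N * R => (ray z.1 z.2)%:E)) => //.
exact/measurable_EFinP.
Qed.

Let iray_integral (K : R) : mu.-integrable (cube N K) ray_integral.
Proof.
exact: (@integrable_fubini_rectangle _ _ _ _ R mu leb (cube N K) I
  (measurable_cube _) _ (fun z : 'rV[R]_N * R => (ray z.1 z.2)%:E) (iray K)).
Qed.

Let ae_ray : {ae mu, forall y, leb.-integrable I (fun r => (ray y r)%:E)}.
Proof.
have h (K : nat) : {ae mu, forall y, cube N K%:R y ->
    leb.-integrable I (fun r => (ray y r)%:E)}.
  exact: (@ae_integrable_rectangle _ _ _ _ R mu leb (cube N K%:R) I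
    (measurable_cube _) _ (fun z : 'rV[R]_N * R => (ray z.1 z.2)%:E) (iray K%:R)).
have := ae_foralln h; apply: filterS => y hy.
have : (\bigcup_k cube N k%:R) y by rewrite bigcup_cube.
by move=> [j _ yj]; exact: hy j yj.
Qed.

Let iray_fine (K : R) : mu.-integrable (cube N K) (EFin \o (fine \o ray_integral)).
Proof.
have mc := @measurable_cube R N K.
apply: le_integrable (iray_integral K) => //.
  apply/measurable_EFinP; apply: measurable_funTS.
  exact: (measurableT_comp _ mray_integral).
by move=> y _ /=; case: (ray_integral y) => //=; rewrite normr0 leey.
Qed.

Let representation_weak phi (K : R) : elementary phi ->
  (forall x, ~ cube N K x -> phi x = 0) ->
  (\int[mu]_x ((p x + fine (ray_integral x)) * phi x)%:E = 0)%E.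
Proof.
move=> nphi phi0; have mc := @measurable_cube R N K; have mI : measurable I by [].
have cphi := elementary_continuous nphi.
have mphi := continuous_measurable_rv cphi.
have [M M0 phiM] := continuous_bounded cphi phi0.
have mray_fine : measurable_fun setT (fine \o ray_integral).
  exact: (measurableT_comp _ mray_integral).
have i1 := integrable_mul_elementary mp (p_cube K) nphi phi0.
have i2 := integrable_mul_elementary mray_fine (iray_fine K) nphi phi0.
transitivity (\int[mu]_x ((p x * phi x)%:E + (fine (ray_integral x) * phi x)%:E))%E.
  by apply: eq_integral => x _; rewrite mulrDl EFinD.
rewrite integralD//.
suff -> : (\int[mu]_x (p x * phi x)%:E =
    - \int[mu]_x (fine (ray_integral x) * phi x)%:E)%E.
  by rewrite addeC subee// integrable_fin_num.
have idiv x : leb.-integrable I (fun r => (dilation_div a phi x r)%:E).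
  apply: integrable_unit; exact: continuous_dilation_div.
transitivity (\int[mu]_x \int[leb]_(r in I) (p x * dilation_div a phi x r)%:E)%E.
  apply: eq_integral => x _; under eq_integral do rewrite EFinM.
  by rewrite integralZl// integral_dilation_div//; lia.
rewrite (@fubini_rectangle _ _ _ _ R mu leb setT I measurableT mI
  (fun z => (p z.1 * dilation_div a phi z.1 z.2)%:E) (i_pdiv nphi phi0)) /=.
transitivity (\int[leb]_(r in I) \int[mu]_(y in cube N K) (- (ray y r * phi y))%:E)%E.
  apply: eq_integral => r /set_mem rI; rewrite (weak_dilated rI nphi phi0).
  rewrite [RHS]integral_mkcond; apply: eq_integral => y _; rewrite patchE.
  case: ifPn => // /negP yK; rewrite phi0 ?mulr0 ?oppr0// => yK'.
  by apply: yK; rewrite inE.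
have iray_phi : (mu \x leb)%E.-integrable (cube N K `*` I)
    (fun z => (- (ray z.1 z.2 * phi z.1))%:E).
  have mKI : measurable (cube N K `*` I : set ('rV[R]_N * measurableTypeR R)).
    exact: measurableX.
  have h := integrableZl mKI M (iray K).
  apply: le_integrable h => //.
    apply/measurable_EFinP; apply: measurable_funTS; apply: measurableT_comp => //.
    by apply: measurable_funM => //; exact: (measurableT_comp mphi measurable_fst).
  move=> z _; rewrite /= lee_fin normrN !normrM mulrC ler_wpM2r//.
  by apply: le_trans (phiM _) _; exact: ler_norm.
rewrite -(@fubini_rectangle _ _ _ _ R mu leb (cube N K) I mc mI
  (fun z => (- (ray z.1 z.2 * phi z.1))%:E) iray_phi) /=.
have -> : (\int[mu]_x (fine (ray_integral x) * phi x)%:E =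
    \int[mu]_(x in cube N K) (fine (ray_integral x) * phi x)%:E)%E.
  rewrite [RHS]integral_mkcond; apply: eq_integral => y _; rewrite patchE.
  case: ifPn => // /negP yK; rewrite phi0 ?mulr0 ?oppr0// => yK'.
  by apply: yK; rewrite inE.
have i2K : mu.-integrable (cube N K) (fun x => (fine (ray_integral x) * phi x)%:E).
  exact: integrableS i2.
rewrite -integralN; last first.
  by rewrite fin_num_adde_defl// fin_numN; exact: integrable_neg_fin_num.
apply: ae_eq_integral => //.
- apply: measurable_int.
  exact: (@integrable_fubini_rectangle _ _ _ _ R mu leb (cube N K) I mc mI
    (fun z : 'rV[R]_N * R => (- (ray z.1 z.2 * phi z.1))%:E) iray_phi).
- by apply: measurableT_comp => //; exact: measurable_int i2K.
apply: filterS ae_ray => y Fy _.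
under eq_integral do rewrite -mulrN mulrC EFinM.
rewrite integralZl// -/(ray_integral y) -[ray_integral y]fineK ?integrable_fin_num//.
by rewrite -EFinM -EFinN mulNr mulrC.
Qed.

(** The fundamental theorem of calculus along rays: [p] vanishes at infinity in
    the sense that it is minus the integral of its gradient over the ray. *)
Let representation : {ae mu, forall y, p y = - fine (ray_integral y)}.
Proof.
have mray_fine : measurable_fun setT (fine \o ray_integral).
  exact: (measurableT_comp _ mray_integral).
have : {ae mu, forall y, p y + fine (ray_integral y) = 0}.
  apply: ae_eq0_test.
  - exact: measurable_funD.
  - move=> K; have mc := @measurable_cube R N K%:R.
    by apply: eq_integrable (integrableD mc (p_cube K%:R) (iray_fine K%:R)).
  - by move=> phi K; exact: representation_weak.
by apply: filterS => y /eqP; rewrite addr_eq0 => /eqP.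
Qed.

(** Cauchy-Schwarz for the integral over [r], as the integral over [r] of
    [2 |m c| |ray| <= nsq * ray_energy + (m c) ^+ 2 * weight], where [m] is the
    integral of [ray] and [c^-1] that of the weight. *)
Let pointwise y : leb.-integrable I (fun r => (ray y r)%:E) ->
  (((N - 2)%:R * fine (ray_integral y) ^+ 2)%:E <=
   (nsq y)%:E * \int[leb]_(r in I) (ray_energy y r)%:E)%E.
Proof.
move=> Fy; set m := fine (ray_integral y); set c : R := (N - 2)%:R.
have c0 : 0 < c by rewrite ltr0n subn_gt0; lia.
have mI : measurable I by [].
have ray_integralE : ray_integral y = m%:E by rewrite fineK//; exact: integrable_fin_num.
have mky : measurable_fun I (fun r => (ray_energy y r)%:E).
  apply/measurable_EFinP; apply: measurable_funTS.
  exact: (measurableT_comp mray_energy (pair1_measurable y)).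
have mw : measurable_fun I (fun r => (weight r)%:E).
  by apply/measurable_EFinP; apply: measurable_funTS; exact: measurable_funX.
have iw : (\int[leb]_(r in I) (weight r)%:E = c^-1%:E)%E.
  by rewrite integral_unit_expn /c; congr (_%:R^-1)%:E; lia.
have step : (`| \int[leb]_(r in I) ((2 * (m * c))%:E * (ray y r)%:E) | <=
    \int[leb]_(r in I) ((nsq y)%:E * (ray_energy y r)%:E +
      ((m * c) ^+ 2)%:E * (weight r)%:E))%E.
  apply: le_trans (le_abse_integral _ _ _) _ => //.
    by apply: measurable_funeM; exact: measurable_int Fy.
  apply: le_ge0_integral => // r rI; rewrite -!EFinM lee_fin.
  rewrite -mulrA normrM ger0_norm//; apply: ler_norm_amgm.
  - by rewrite mulr_ge0// ray_energy_ge0.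
  - by rewrite mulr_ge0 ?sqr_ge0 ?weight_ge0.
  - rewrite exprMn.
    have -> : nsq y * ray_energy y r * ((m * c) ^+ 2 * weight r) =
        (m * c) ^+ 2 * (nsq y * (weight r * ray_energy y r)).
      by ring.
    by rewrite ler_wpM2l ?sqr_ge0// ray_sqr.
move: step; rewrite integralZl// -/(ray_integral y) ray_integralE -EFinM.
rewrite ge0_integralD//; last 4 first.
- by move=> r rI; rewrite mule_ge0 ?lee_fin// ray_energy_ge0.
- exact: measurable_funeM.
- by move=> r rI; rewrite mule_ge0 ?lee_fin ?sqr_ge0 ?weight_ge0.
- exact: measurable_funeM.
rewrite ge0_integralZl//; last 2 first.
- by move=> r rI; rewrite lee_fin ray_energy_ge0.
- by rewrite lee_fin.
rewrite ge0_integralZl//; last by rewrite lee_fin sqr_ge0.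
rewrite iw -EFinM.
have -> : (m * c) ^+ 2 * c^-1 = c * m ^+ 2 by field; rewrite gt_eqF.
have -> : `|(2 * (m * c) * m)%:E|%E = (c * m ^+ 2 + c * m ^+ 2)%:E.
  by rewrite /= ger0_norm; [congr EFin; ring|nra].
by rewrite EFinD leeD2rE.
Qed.

(** Integrating [pointwise] over [y] and exchanging the integrals brings in
    [int_int_ray_energy], that is one factor [(N - 2)^-1] from the weight and
    another one from [ray_energy]. *)
Lemma hardy_one_pole :
  (((N%:R - 2) ^+ 2 / 4)%:E *
   \int[mu]_y ((enorm (y - a) ^+ 2)%:E^-1 * (p y ^+ 2)%:E) <=
   \int[mu]_y (\sum_i g i y ^+ 2)%:E)%E.
Proof.
set c : R := (N - 2)%:R.
have c0 : 0 < c by rewrite ltr0n subn_gt0; lia.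
have cE : N%:R - 2 = c by rewrite /c natrB//; lia.
have mnsq : measurable_fun setT nsq.
  apply: measurable_sum => i; apply: measurable_funX.
  by apply: measurable_funB => //; exact: measurable_coord.
have nE y : enorm (y - a) ^+ 2 = nsq y.
  by rewrite enorm_sqr; apply: eq_bigr => i _; rewrite !mxE.
have mkE : measurable_fun setT (fun z : 'rV[R]_N * R => (ray_energy z.1 z.2)%:E).
  exact/measurable_EFinP.
have mik : measurable_fun setT (fun y => \int[leb]_(r in I) (ray_energy y r)%:E)%E.
  exact: (@measurable_integral_rectangle _ _ _ _ R leb I _
    (fun z : 'rV[R]_N * R => (ray_energy z.1 z.2)%:E)).
have le1 : (\int[mu]_y ((enorm (y - a) ^+ 2)%:E^-1 * (p y ^+ 2)%:E) <=
    \int[mu]_y (c^-1%:E * \int[leb]_(r in I) (ray_energy y r)%:E))%E.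
  apply: ae_ge0_le_integral => //.
  - move=> y _; rewrite mule_ge0 ?lee_fin ?sqr_ge0// nE inve_ge0 lee_fin//.
  - apply: emeasurable_funM.
      by under eq_fun do rewrite nE; exact: measurable_inve_EFin.
    by apply/measurable_EFinP; exact: measurable_funX.
  - move=> y _; apply: mule_ge0; first by rewrite lee_fin invr_ge0 ltW.
    by apply: integral_ge0 => r rI; rewrite lee_fin ray_energy_ge0.
  - exact: measurable_funeM.
  apply: filterS2 representation ae_ray => y py /pointwise + _.
  have -> : fine (ray_integral y) ^+ 2 = p y ^+ 2 by rewrite py sqrrN.
  rewrite nE -/c.
  have : (0 <= \int[leb]_(r in I) (ray_energy y r)%:E)%E.
    by apply: integral_ge0 => r rI; rewrite lee_fin ray_energy_ge0.
  move: (\int[leb]_(r in I) (ray_energy y r)%:E)%E => X X0 h.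
  (* At the pole, [pointwise] forces [p y = 0], and [+oo * 0 = 0]. *)
  have [n0|n0] := eqVneq (nsq y) 0.
    move: h; rewrite n0 mul0e lee_fin pmulr_rle0// => p0.
    have -> : p y ^+ 2 = 0 by apply/eqP; rewrite eq_le p0 sqr_ge0.
    by rewrite mule0; apply: mule_ge0 => //; rewrite lee_fin invr_ge0 ltW.
  have n1 : 0 < nsq y by rewrite lt0r n0 nsq_ge0.
  rewrite inver (negbTE n0) lee_pdivrMl// muleCA lee_pdivlMl//.
rewrite (_ : (\int[mu]_y (\sum_i g i y ^+ 2)%:E)%E = energy%:E)//.
apply: (@le_trans _ _ (((N%:R - 2) ^+ 2 / 4)%:E * (c^-1 * (4 / c * energy))%:E)%E).
  rewrite lee_wpmul2l ?lee_fin ?divr_ge0 ?sqr_ge0//; apply: le_trans le1 _.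
  rewrite ge0_integralZl//; last 2 first.
  - by move=> y _; apply: integral_ge0 => r rI; rewrite lee_fin ray_energy_ge0.
  - by rewrite lee_fin invr_ge0 ltW.
  rewrite EFinM; apply: lee_wpmul2l; first by rewrite lee_fin invr_ge0 ltW.
  rewrite (@tonelli_rectangle _ _ _ _ R mu leb setT I measurableT _
    (fun z : 'rV[R]_N * R => (ray_energy z.1 z.2)%:E))//= ?int_int_ray_energy//.
  by move=> y r _ rI; rewrite lee_fin ray_energy_ge0.
rewrite -EFinM lee_fin cE le_eqVlt; apply/orP; left; apply/eqP.
by field; rewrite gt_eqF.
Qed.

End hardy.

(** * Weak derivatives of continuously differentiable functions *)
Section integration_by_parts.
Context (R : realType) (N : nat).
Local Notation mu := (vol R N).
Local Notation leb := (@lebesgue_measure R).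
Local Notation I := (`]0%R, 1%R[%classic : set R).
Implicit Types (psi : 'rV[R]_N -> R).

Lemma is_derive_line psi (x : 'rV[R]_N) (i : 'I_N) (t : R) :
  derivable psi (x + t *: delta_mx 0 i) (delta_mx 0 i) ->
  is_derive t 1 (fun t : R => psi (x + t *: delta_mx 0 i))
    (partial i psi (x + t *: delta_mx 0 i)).
Proof.
set e : 'rV[R]_N := delta_mx 0 i; move=> dpsi.
have quotE : (fun h : R => h^-1 *: (psi (x + (h *: 1 + t) *: e) - psi (x + t *: e))) =
    (fun h : R => h^-1 *: (psi (h *: e + (x + t *: e)) - psi (x + t *: e))).
  apply/funext => h; congr (_ *: (psi _ - _)).
  by rewrite scalerDl [h *: 1]mulr1 addrCA.
split; first by rewrite /derivable /= quotE; exact: dpsi.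
by rewrite /derive /= quotE.
Qed.

(** By translation invariance, 0 is the integral of [psi (x + e) - psi x]; this
    difference is the integral of [partial i psi (x + t *: e)] over
    [0 < t < 1], and translation invariance applies again for each [t]. *)
Lemma integral_partial_eq0 psi (K : R) (i : 'I_N) :
  continuous psi -> (forall x, derivable psi x (delta_mx 0 i)) ->
  continuous (partial i psi) -> (forall x, ~ cube N K x -> psi x = 0) ->
  (\int[mu]_x (partial i psi x)%:E = 0)%E.
Proof.
move=> cpsi dpsi cdpsi psi0; set e : 'rV[R]_N := delta_mx 0 i.
have mI : measurable I by [].
have dpsi0 := partial_out i psi0.
have [M M0 dpsiM] := continuous_bounded cdpsi dpsi0.
have mpsi := continuous_measurable_rv cpsi.
have mdpsi := continuous_measurable_rv cdpsi.
have ipsi : mu.-integrable setT (EFin \o psi).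
  have [C C0 psiC] := continuous_bounded cpsi psi0.
  have := @integrable_mul_cube R N (cst 1) psi K C (measurable_cst _)
    (integrable_cube1 _ _) mpsi psiC psi0.
  by apply: eq_integrable => // x _ /=; rewrite mul1r.
have idpsi : mu.-integrable setT (EFin \o partial i psi).
  have := @integrable_mul_cube R N (cst 1) (partial i psi) (K + 1) M (measurable_cst _)
    (integrable_cube1 _ _) mdpsi dpsiM dpsi0.
  by apply: eq_integrable => // x _ /=; rewrite mul1r.
have transl (t : R) (f : 'rV[R]_N -> R) : mu.-integrable setT (EFin \o f) ->
    (\int[mu]_x (f (x + t *: e))%:E = \int[mu]_x (f x)%:E)%E.
  move=> fi; have := integral_affine (t *: e) (@ltr01 R) fi.
  rewrite invr1 expr1n mul1e => <-; apply: eq_integral => x _ /=.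
  by rewrite /affine scale1r.
have mline : measurable_fun setT (fun z : 'rV[R]_N * R => z.1 + z.2 *: e).
  apply: measurable_rv => j; under eq_fun do rewrite !mxE.
  apply: measurable_funD.
    exact: (measurableT_comp (measurable_coord j) measurable_fst).
  by apply: measurable_funM => //; exact: measurable_snd.
have iline : (mu \x leb)%E.-integrable (setT `*` I)
    (fun z => (partial i psi (z.1 + z.2 *: e))%:E).
  apply: integrable_rectangle => //.
    by apply/measurable_EFinP; exact: (measurableT_comp mdpsi mline).
  have iabs : mu.-integrable setT (EFin \o (fun x => `|partial i psi x|)).
    exact: integrable_abse idpsi.
  have fin : (\int[mu]_x `|partial i psi x|%:E \is a fin_num)%E.
    exact: integrable_fin_num iabs.
  apply: le_lt_trans (_ : (\int[mu]_x `|partial i psi x|%:E * leb I < +oo)%E).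
    apply: integral_le_cst => // t _; rewrite integral_ge0//=.
    by rewrite (transl t _ iabs).
  rewrite lebesgue_measure_itv /= lte_fin ltr01 oppr0 adde0 mule1.
  by rewrite -ge0_fin_numE ?integral_ge0.
transitivity (\int[leb]_(t in I) \int[mu]_x (partial i psi (x + t *: e))%:E)%E.
  under [RHS]eq_integral do rewrite (transl _ _ idpsi).
  rewrite integral_cst//= lebesgue_measure_itv /= lte_fin ltr01 oppr0 adde0.
  by rewrite mule1.
rewrite -(@fubini_rectangle _ _ _ _ R mu leb setT I measurableT mI
  (fun z => (partial i psi (z.1 + z.2 *: e))%:E) iline) /=.
transitivity (\int[mu]_x ((psi (x + 1 *: e))%:E - (psi x)%:E))%E.
  apply: eq_integral => x _.
  rewrite (integral_unit_derive (fun t => is_derive_line (dpsi (x + t *: e)))).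
    by rewrite scale0r addr0 EFinB.
  move=> t; apply: (@continuous_comp _ _ _ (fun t : R => x + t *: e) (partial i psi)).
    by apply: cvgD; [exact: cvg_cst|apply: cvgZr_tmp; exact: cvg_id].
  exact: cdpsi.
rewrite integralB//=.
  by rewrite (transl 1 _ ipsi) subee//; exact: integrable_fin_num.
have iabs : mu.-integrable setT (EFin \o (fun x => `|psi x|)).
  exact: integrable_abse ipsi.
apply/integrableP; split.
  apply/measurable_EFinP; apply: (measurableT_comp mpsi).
  rewrite (_ : (fun x => _) = affine 1 (1 *: e)); first exact: measurable_affine.
  by apply/funext => x; rewrite /affine !scale1r.
have := transl 1 _ iabs => /= ->.
by rewrite -ge0_fin_numE ?integral_ge0//; exact: integrable_fin_num iabs.
Qed.

Lemma test_function_cube (phi : 'rV[R]_N -> R) : test_function phi ->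
  exists K : R, forall x, ~ cube N K x -> phi x = 0.
Proof.
move=> [_ /compact_bounded[M [Mr /(_ (`|M| + 1))]]].
rewrite ltr_pwDr// ?ler_norm// => /(_ isT) h.
exists (`|M| + 2) => x xM; apply/eqP; apply: contra_notT xM => phix i.
have /h : closure [set x | phi x != 0] x by exact: subset_closure.
rewrite /= => xM; have : `|x 0 i| <= `|x|.
  by rewrite [leRHS]/Num.norm/= mx_normrE;
  exact: (le_bigmax _ (fun ij => `|x ij.1 ij.2|) (0, i)).
move=> /le_trans/(_ xM); rewrite in_itv/= ler_norml => /andP[h1 h2].
by apply/andP; split; lra.
Qed.

(** [integral_partial_eq0] for the product [u * phi]. *)
Lemma weak_partial_classical i (u u' : 'rV[R]_N -> R) :
  continuous u -> continuous u' ->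
  (forall x, is_derive x (delta_mx 0 i : 'rV[R]_N) u (u' x)) -> weak_partial i u u'.
Proof.
move=> cu cu' du phi tphi; have [K phi0] := test_function_cube tphi.
have [sphi _] := tphi.
have [cphi dphi] : continuous phi /\ forall i x, derivable phi x (delta_mx 0 i).
  exact: sphi [::].
have [cdphi _] : continuous (partial i phi) /\ _ := sphi [:: i].
have dpsi x : is_derive x (delta_mx 0 i : 'rV[R]_N) (u * phi)
    (u x *: partial i phi x + phi x *: u' x).
  by apply: is_deriveM; split => //; exact: dphi.
have partialE : partial i (u * phi) = fun x => u x * partial i phi x + u' x * phi x.
  apply/funext => x; have [_] := dpsi x; rewrite /partial => ->.
  by rewrite [phi x *: _]mulrC.
have cpsi : continuous (u * phi) by move=> x; exact: (cvgM (cu x) (cphi x)).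
have cdpsi : continuous (partial i (u * phi)).
  by rewrite partialE => x; exact: (cvgD (cvgM (cu x) (cdphi x)) (cvgM (cu' x) (cphi x))).
have int0 : (\int[mu]_x (partial i (u * phi) x)%:E = 0)%E.
  apply: (@integral_partial_eq0 _ K) => //.
  by move=> x xK; rewrite -[LHS]/(u x * phi x) phi0 ?mulr0.
have ic (f : 'rV[R]_N -> R) L : continuous f -> (forall x, ~ cube N L x -> f x = 0) ->
    mu.-integrable setT (EFin \o f).
  move=> cf f0; have [C C0 fC] := continuous_bounded cf f0.
  have := @integrable_mul_cube R N (cst 1) f L C (measurable_cst _)
    (integrable_cube1 _ _) (continuous_measurable_rv cf) fC f0.
  by apply: eq_integrable => // x _ /=; rewrite mul1r.
have i1 : mu.-integrable setT (fun x => (u x * partial i phi x)%:E).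
  apply: (ic (fun x => u x * partial i phi x) (K + 1)).
    by move=> x; exact: (cvgM (cu x) (cdphi x)).
  by move=> x xK; rewrite (partial_out (K := K))// mulr0.
have i2 : mu.-integrable setT (fun x => (u' x * phi x)%:E).
  apply: (ic (fun x => u' x * phi x) K).
    by move=> x; exact: (cvgM (cu' x) (cphi x)).
  by move=> x xK; rewrite phi0// mulr0.
have f1 := integrable_fin_num measurableT i1.
have f2 := integrable_fin_num measurableT i2.
move: int0; rewrite partialE; under eq_integral do rewrite EFinD.
rewrite integralD// -(fineK f1) -(fineK f2) -EFinD => -[] /eqP.
by rewrite addr_eq0 => /eqP.
Qed.

End integration_by_parts.

(** * Integrability of powers of a quadratic *)
Section decay.
Context (R : realType) (N : nat).
Local Notation mu := (vol R N).

Definition quad (B : R) (x : 'rV[R]_N) : R := B + \sum_i x 0 i ^+ 2.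

Lemma quad_ge B x : B <= quad B x.
Proof. by rewrite lerDl sumr_ge0// => i _; exact: sqr_ge0. Qed.

Lemma elementary_quad B : elementary (quad B).
Proof.
apply: elementary_add; first exact: elementary_cst.
elim: (index_enum _) => [|i s IH].
  by under eq_fun do rewrite big_nil; exact: elementary_cst.
under eq_fun do rewrite big_cons expr2; apply: elementary_add => //.
by apply: elementary_mul; exact: elementary_coord.
Qed.

Lemma measurable_quad B : measurable_fun setT (quad B).
Proof.
apply: continuous_measurable_rv; apply: elementary_continuous.
exact: elementary_quad.
Qed.

Lemma is_derive_coord i j (x : 'rV[R]_N) :
  is_derive x (delta_mx 0 i : 'rV[R]_N) (fun x : 'rV[R]_N => x 0 j) (j == i)%:R.
Proof.
split; first by apply: elementary_derivable; exact: elementary_coord.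
exact: partial_coord.
Qed.

Lemma partial_quad B i x : partial i (quad B) x = 2 * x 0 i.
Proof.
have h j : is_derive x (delta_mx 0 i : 'rV[R]_N)
    (fun x : 'rV[R]_N => x 0 j ^+ 2) ((2 * x 0 j) * (j == i)%:R).
  rewrite (_ : (fun x : 'rV[R]_N => _) =
    (fun x : 'rV[R]_N => x 0 j) * (fun x => x 0 j)); last first.
    by apply/funext => y; rewrite -[RHS]/(y 0 j * y 0 j) expr2.
  apply: is_derive_eq (is_deriveM (is_derive_coord i j x) (is_derive_coord i j x)) _.
  by rewrite /GRing.scale /=; ring.
have hs : is_derive x (delta_mx 0 i : 'rV[R]_N)
    (fun x : 'rV[R]_N => \sum_j x 0 j ^+ 2) (\sum_j (2 * x 0 j) * (j == i)%:R).
  rewrite (_ : (fun x : 'rV[R]_N => _) =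
    \sum_j (fun x : 'rV[R]_N => x 0 j ^+ 2)); last first.
    by apply/funext => y; rewrite fct_sumE.
  exact: is_derive_sum.
rewrite /partial -[quad B]/(cst B + (fun x : 'rV[R]_N => \sum_j x 0 j ^+ 2)).
have [_ ->] := is_deriveD (is_derive_cst B x (delta_mx 0 i : 'rV[R]_N)) hs.
rewrite add0r (bigD1 i)//= eqxx mulr1 big1 ?addr0// => j /negbTE ->.
by rewrite mulr0.
Qed.

Definition decay (p : R) (t : R) : R := (t `^ p)^-1.

Lemma decay_gt0 p t : 0 < t -> 0 < decay p t.
Proof. by move=> t0; rewrite invr_gt0 powR_gt0. Qed.

Lemma decay_le p s t : 0 <= p -> 0 < s -> s <= t -> decay p t <= decay p s.
Proof.
move=> p0 s0 st; have t0 := lt_le_trans s0 st.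
rewrite lef_pV2 ?posrE ?powR_gt0//; apply: ge0_ler_powR => //;
  by rewrite nnegrE ltW.
Qed.

Lemma measurable_decay p B : measurable_fun setT (fun x => decay p (quad B x)).
Proof.
apply: (measurableT_comp (@measurable_invr R)).
exact: (measurableT_comp (measurable_powR _) (measurable_quad B)).
Qed.

Lemma vol_cube (K : R) : 0 <= K -> vol R N (cube N K) = ((2 * K) ^+ N)%:E.
Proof.
move=> K0; rewrite /cube vol_box.
have h : lebesgue_measure `](- K), K[%classic = (2 * K)%:E :> \bar R.
  rewrite lebesgue_measure_itv /= lte_fin; case: ifPn => [_|].
    by congr EFin; ring.
  rewrite -leNgt => KK; have K00 : K = 0 by lra. by rewrite K00 mulr0.
by rewrite (eq_bigr (fun=> (2 * K)%:E)) // prodEFin prodr_const card_ord.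
Qed.

(** The cube of half-side [2 ^ k.+1] has volume of order [2 ^ (k * N)], and
    outside the cube of half-side [2 ^ k] the quadratic is at least [4 ^ k].
    The resulting series is geometric of ratio [2 ^ N / 4 ^ p < 1]. *)
Lemma integrable_decay (p B : R) : 1 <= B -> N%:R < 2 * p ->
  mu.-integrable setT (fun x => (decay p (quad B x))%:E).
Proof.
move=> B1 Np; have p0 : 0 < p by have := ler0n R N; lra.
pose rho : R := decay p 4.
pose f (k : nat) (x : 'rV[R]_N) : \bar R :=
  ((rho ^+ k)%:E * (\1_(cube N (2 ^+ k.+1)) x)%:E)%E.
have rho0 : 0 < rho by exact: decay_gt0.
have q0 x : 0 < quad B x by apply: lt_le_trans (quad_ge B x); lra.
have f0 k x : (0 <= f k x)%E.
  rewrite /f -EFinM lee_fin; apply: mulr_ge0; last by rewrite indicE ler0n.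
  by rewrite exprn_ge0// ltW.
have dominated x : ((decay p (quad B x))%:E <= \sum_(k <oo) f k x)%E.
  (* The smallest dyadic cube containing [x]; in the unit cube, the hypothesis
     [1 <= B] replaces the lower bound by the next smaller cube. *)
  have [k hk] : exists k, ((decay p (quad B x))%:E <= f k x)%E.
    have exk : exists k, `[< cube N (2 ^+ k) x >].
      have : (\bigcup_k cube N k%:R) x by rewrite bigcup_cube.
      move=> [k _ xk]; exists k; apply/asboolP; apply: cube_le xk.
      by rewrite -natrX ler_nat ltnW// ltn_expl.
    have [[|k] /asboolP xk mink] := ex_minnP exk.
      exists 0%N; rewrite /f expr0 mul1e lee_fin indicE mem_set.
        rewrite -(_ : decay p 1 = 1); last by rewrite /decay powR1 invr1.
        by apply: decay_le => //; [exact: ltW|apply: le_trans (quad_ge B x)].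
      by apply: cube_le xk; rewrite expr0 expr1 ler1n.
    exists k; rewrite /f indicE mem_set// mule1 lee_fin.
    have -> : rho ^+ k = decay p (4 ^+ k).
      rewrite /rho /decay exprVn; congr (_^-1).
      by rewrite -[4 ^+ k]powR_mulrn// powRAC powR_mulrn// powR_ge0.
    apply: decay_le; [exact: ltW|by rewrite exprn_gt0|].
    have /existsNP[i /negP xi] : ~ cube N (2 ^+ k) x.
      by move=> xk'; have := mink k; rewrite ltnn => h; apply/notF/h/asboolP.
    have {}xi : 2 ^+ k <= `|x 0 i|.
      by move: xi; rewrite in_itv/= -ltr_norml -leNgt.
    apply: (@le_trans _ _ (x 0 i ^+ 2)).
      rewrite -[x 0 i ^+ 2]real_normK ?num_real//.
      have -> : 4 ^+ k = (2 ^+ k) ^+ 2 :> R.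
        by rewrite -exprM mulnC exprM; congr (_ ^+ _); rewrite -natrX.
      by rewrite ler_sqr// nnegrE exprn_ge0.
    rewrite /quad (bigD1 i)//= addrCA lerDl addr_ge0 ?sumr_ge0//.
      by lra.
    by move=> j _; exact: sqr_ge0.
  apply: le_trans hk _.
  rewrite (nneseriesD1 (n := k))//.
  by rewrite leeDl// nneseries_ge0.
have intf k : (\int[mu]_x f k x = (4 ^+ N * (rho * 2 ^+ N) ^+ k)%:E)%E.
  rewrite /f ge0_integralZl//; last 2 first.
  - by apply/measurable_EFinP; apply: measurable_indic; exact: measurable_cube.
  - by rewrite lee_fin exprn_ge0// ltW.
  rewrite integral_indic//; last exact: measurable_cube.
  rewrite setIT (_ : _ (cube N _) = ((2 * 2 ^+ k.+1) ^+ N)%:E); last first.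
    by apply: vol_cube; rewrite exprn_ge0.
  rewrite -EFinM; congr EFin.
  have -> : 2 * 2 ^+ k.+1 = 4 * 2 ^+ k :> R by rewrite exprS; ring.
  by rewrite !exprMn [(2 ^+ k) ^+ N]exprAC; ring.
apply/integrableP; split.
  by apply/measurable_EFinP; exact: measurable_decay.
pose z := rho * 2 ^+ N.
have z0 : 0 <= z by rewrite mulr_ge0 ?exprn_ge0// ltW.
have z1 : z < 1.
  rewrite /z /rho /decay mulrC ltr_pdivrMr ?powR_gt0// mul1r.
  have -> : 4 = 2 ^+ 2 :> R by rewrite -natrX.
  rewrite -(@powR_mulrn _ 2 2)// -powRrM -(@powR_mulrn _ 2 N)//.
  have -> : 2%:R * p = N%:R + (2 * p - N%:R) by ring.
  rewrite powRD ?pnatr_eq0 ?implybT// ltr_pMr ?powR_gt0//.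
  rewrite -[X in X < _](_ : 1 `^ (2 * p - N%:R) = 1); last by rewrite powR1.
  by apply: gt0_ltr_powR; rewrite ?nnegrE ?subr_gt0// ltr1n.
apply: (@le_lt_trans _ _ (\int[mu]_x \sum_(k <oo) f k x)%E).
  apply: le_ge0_integral => // x _; rewrite gee0_abs//.
  by rewrite lee_fin ltW// decay_gt0.
rewrite integral_nneseries//; last first.
  move=> k; apply/measurable_EFinP; apply: measurable_funM => //.
  by apply: measurable_indic; exact: measurable_cube.
apply: (@le_lt_trans _ _ (4 ^+ N / (1 - z))%:E); last exact: ltry.
apply: lime_le.
  by apply: is_cvg_nneseries => k _ _; exact: integral_ge0.
apply: nearW => n; under eq_bigr do rewrite intf.
rewrite sumEFin lee_fin -mulr_sumr ler_wpM2l ?exprn_ge0//.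
have zp : 0 < z by rewrite mulr_gt0// exprn_gt0.
have := @geometric_le_lim R n 1 z ler01 zp.
rewrite ger0_norm// mul1r => /(_ z1); apply: le_trans.
rewrite /series /= le_eqVlt; apply/orP; left; apply/eqP.
by apply: eq_bigr => k _; rewrite mul1r.
Qed.

End decay.

(** * The trial functions *)
Section trial.
Context (R : realType) (N : nat).
Local Notation mu := (vol R N).
Variables (B b d : R).
Hypotheses (B1 : 1 <= B) (b0 : 0 < b) (d0 : 0 < d).

(** The factor [damping] puts the trial function in [L^2] for [d > 0], where
    [q ^ - b] alone may fail to be; it tends to 1 with [d]. *)
Definition damping (x : 'rV[R]_N) : R := (1 + d * quad B x)^-1.
Definition trial (x : 'rV[R]_N) : R := decay b (quad B x) * damping x.
Definition dtrial (i : 'I_N) (x : 'rV[R]_N) : R :=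
  - trial x * ((b + 1 - damping x) / quad B x) * (2 * x 0 i).

Let q0 (x : 'rV[R]_N) : 0 < quad B x.
Proof. exact: lt_le_trans (lt_le_trans ltr01 B1) (quad_ge B x). Qed.

Let dq0 (x : 'rV[R]_N) : 0 < 1 + d * quad B x.
Proof. by rewrite addr_gt0// mulr_gt0. Qed.

Lemma damping_gt0 x : 0 < damping x.
Proof. by rewrite invr_gt0. Qed.

Lemma damping_le1 x : damping x <= 1.
Proof. by rewrite invf_le1// lerDl mulr_ge0// ltW. Qed.

(** The power of [q] is split off so that both integrals of the Hardy
    inequality involve the same integrable factor [q ^ - (2 b + 1)]. *)
Lemma trial_sqr x :
  trial x ^+ 2 = decay (2 * b + 1) (quad B x) * damping x ^+ 2 * quad B x.
Proof.
rewrite /trial exprMn /decay.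
have -> : 2 * b + 1 = b + (b + 1) by ring.
rewrite !powRD; try by rewrite ?(gt_eqF (q0 x)) ?implybT.
rewrite powRr1 ?ltW//; field.
by rewrite !gt_eqF// powR_gt0.
Qed.

(** By the chain rule the gradient has length
    [2 trial x (b + 1 - damping x) |x| / q], where [1 - damping x] is the
    logarithmic derivative of the damping times [- q]; and [|x| ^+ 2 <= q]. *)
Lemma dtrial_sqr x : \sum_i dtrial i x ^+ 2 <=
  4 * (decay (2 * b + 1) (quad B x) * damping x ^+ 2 * (b + 1 - damping x) ^+ 2).
Proof.
have -> : \sum_i dtrial i x ^+ 2 = 4 * (decay (2 * b + 1) (quad B x) * damping x ^+ 2 *
    (b + 1 - damping x) ^+ 2) * ((\sum_i x 0 i ^+ 2) / quad B x).
  rewrite mulrA mulr_sumr mulr_suml; apply: eq_bigr => i _.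
  rewrite /dtrial mulrAC 2!exprMn sqrrN trial_sqr; field.
  by rewrite gt_eqF.
have Q0 : 0 <= 4 * (decay (2 * b + 1) (quad B x) * damping x ^+ 2 *
    (b + 1 - damping x) ^+ 2).
  by rewrite mulr_ge0// mulr_ge0 ?sqr_ge0// mulr_ge0 ?sqr_ge0// ltW// decay_gt0.
rewrite ler_piMr// ler_pdivrMr// mul1r /quad lerDr; exact: le_trans ler01 B1.
Qed.

Let is_derive_damping (t : R) : 0 < t ->
  is_derive t 1 (fun t : R => (1 + d * t)^-1) (- (1 + d * t) ^- 2 *: d).
Proof.
move=> t0; apply: (@is_deriveV R (fun t => 1 + d * t)).
  by rewrite gt_eqF// addr_gt0// mulr_gt0.
rewrite (_ : (fun t : R => _) = cst 1 + (d \*: id)); last by apply/funext.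
by apply: is_derive_eq; rewrite add0r [d *: 1]mulr1.
Qed.

Let is_derive_decay (t : R) : 0 < t ->
  is_derive t 1 (decay b) (- (t `^ b) ^- 2 *: (b * t `^ (b - 1))).
Proof.
move=> t0; apply: (@is_deriveV R (fun t => t `^ b)).
  by rewrite gt_eqF// powR_gt0.
exact: is_derive1_powR.
Qed.

Lemma is_derive_trial i x :
  is_derive x (delta_mx 0 i : 'rV[R]_N) trial (dtrial i x).
Proof.
have nq := elementary_quad N B.
pose F (t : R) := decay b t * (1 + d * t)^-1.
set t := quad B x.
have t0 : 0 < t by exact: q0.
have tn : t != 0 by rewrite gt_eqF.
have dF : is_derive t 1 F (- (F t) * ((b + 1 - (1 + d * t)^-1) / t)).
  apply: is_derive_eq (is_deriveM (is_derive_decay t0) (is_derive_damping t0)) _.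
  rewrite /GRing.scale /= /F /decay powRB; last by rewrite tn implybT.
  rewrite powRr1 ?ltW//; field.
  by rewrite tn !gt_eqF ?powR_gt0// dq0.
have := is_derive_comp_real (delta_mx 0 i) dF (elementary_differentiable nq x).
by rewrite -[X in _ * X]/(partial i (quad B) x) partial_quad.
Qed.

Let continuous_quad : continuous (@quad R N B).
Proof. by apply: elementary_continuous; exact: elementary_quad. Qed.

Let continuous_comp_quad (F F' : R -> R) :
  (forall t : R, 0 < t -> is_derive t 1 F (F' t)) ->
  continuous (fun x : 'rV[R]_N => F (quad B x)).
Proof.
move=> dF x; apply: (@continuous_comp _ _ _ (@quad R N B) F).
  exact: continuous_quad.
by apply: differentiable_continuous; apply/derivable1_diffP; have [] := dF _ (q0 x).
Qed.

Let continuous_damping : continuous damping.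
Proof. exact: continuous_comp_quad is_derive_damping. Qed.

Lemma continuous_trial : continuous trial.
Proof.
have cdecay := continuous_comp_quad is_derive_decay.
by move=> x; exact: (cvgM (cdecay x) (@continuous_damping x)).
Qed.

Lemma continuous_dtrial i : continuous (dtrial i).
Proof.
have cinv : continuous (fun x : 'rV[R]_N => (quad B x)^-1).
  apply: (@continuous_comp_quad GRing.inv (fun t => - t ^- 2 *: 1)) => t t0.
  by apply: (@is_deriveV R id); rewrite ?gt_eqF.
have cx : continuous (fun x : 'rV[R]_N => 2 * x 0 i).
  apply: elementary_continuous.
  by apply: elementary_mul; [exact: elementary_cst|exact: elementary_coord].
have cb : continuous (fun x : 'rV[R]_N => b + 1 - damping x).
  by move=> x; exact: (cvgB (cvg_cst (b + 1)) (@continuous_damping x)).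
move=> x; exact: (cvgM (cvgM (cvgN (@continuous_trial x)) (cvgM (cb x) (cinv x))) (cx x)).
Qed.

Hypothesis hb : N%:R < 2 * (2 * b + 1).

Let Q (x : 'rV[R]_N) := decay (2 * b + 1) (quad B x).

Let Q0 (x : 'rV[R]_N) : 0 <= Q x.
Proof. by rewrite ltW// decay_gt0. Qed.

Lemma integrable_trial_sqr : mu.-integrable setT (fun x => (trial x ^+ 2)%:E).
Proof.
apply: le_integrable (integrableZl measurableT d^-1 (integrable_decay B1 hb)) => //.
  apply/measurable_EFinP; apply: measurable_funX.
  by apply: continuous_measurable_rv; exact: continuous_trial.
move=> x _; rewrite /= lee_fin -/(Q x).
rewrite !ger0_norm ?sqr_ge0 ?mulr_ge0 ?invr_ge0 ?(ltW d0) ?powR_ge0//.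
rewrite trial_sqr -/(Q x) -mulrA mulrC ler_wpM2r//.
rewrite /damping exprVn ler_pdivrMl ?exprn_gt0// -ler_pdivrMr ?invr_gt0// invrK.
have := q0 x; set t := quad B x => t0.
have := mulr_gt0 d0 t0; nra.
Qed.

Lemma integrable_dtrial_sqr i : mu.-integrable setT (fun x => (dtrial i x ^+ 2)%:E).
Proof.
have iQ := integrable_decay B1 hb.
apply: le_integrable (integrableZl measurableT (4 * (b + 1) ^+ 2) iQ) => //.
  apply/measurable_EFinP; apply: measurable_funX.
  by apply: continuous_measurable_rv; exact: continuous_dtrial.
have b1 : 0 <= b + 1 by rewrite addr_ge0// ltW.
move=> x _; rewrite /= lee_fin -/(Q x) !ger0_norm ?sqr_ge0 ?mulr_ge0 ?sqr_ge0//.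
apply: (@le_trans _ _ (\sum_i dtrial i x ^+ 2)).
  by rewrite (bigD1 i)//= lerDl sumr_ge0// => j _; exact: sqr_ge0.
apply: le_trans (dtrial_sqr x) _; rewrite -/(Q x).
have -> : 4 * (Q x * damping x ^+ 2 * (b + 1 - damping x) ^+ 2) =
    4 * (damping x ^+ 2 * (b + 1 - damping x) ^+ 2) * Q x by ring.
rewrite ler_wpM2r// ler_wpM2l// -exprMn.
have s0 := damping_gt0 x; have s1 := damping_le1 x.
have sb : 0 <= b + 1 - damping x by have := b0; lra.
have s0' := ltW s0; rewrite ler_sqr ?nnegrE ?mulr_ge0//.
by have := ler_wpM2r sb s1; have := s0; lra.
Qed.

End trial.

(** * The potential and the sharpness of the constant *)

(* [L2] and [weak_gradient] are stated with [lebesgue_rv], to which [vol]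
   unfolds. *)
Transparent vol.

Lemma normc_sqr (R : realType) (z : R[i]) :
  Normc.normc z ^+ 2 = complex.Re z ^+ 2 + complex.Im z ^+ 2.
Proof.
by case: z => x y; rewrite /Normc.normc /= sqr_sqrtr// addr_ge0// sqr_ge0.
Qed.

Section potential.
Context (R : realType) (N n : nat) (a : 'I_n -> 'rV[R]_N).
Local Open Scope ereal_scope.

Lemma V_minfty_le (i : 'I_n) x : V_minfty a x <= (enorm (x - a i) ^+ 2)%:E^-1.
Proof. by rewrite /V_minfty (bigD1 i)//= ge_min lexx. Qed.

Lemma V_minfty_ge (r : \bar R) x :
  (forall i, r <= (enorm (x - a i) ^+ 2)%:E^-1) -> r <= V_minfty a x.
Proof.
move=> h; rewrite /V_minfty; elim/big_ind: _ => //; first exact: leey.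
by move=> s t rs rt; rewrite le_min rs rt.
Qed.

Lemma V_minfty_ge0 x : 0 <= V_minfty a x.
Proof. by apply: V_minfty_ge => i; rewrite inve_ge0 lee_fin sqr_ge0. Qed.

(** Young's inequality
    [(x - a) ^+ 2 <= (1 + eta) * x ^+ 2 + (1 + eta^-1) * a ^+ 2], where the
    last terms are absorbed by the constant [B] of the quadratic. *)
Lemma V_minfty_ge_quad (eta B : R) x : (0 < eta)%R ->
  (forall i, \sum_j a i 0 j ^+ 2 <= eta * B)%R -> (1 <= B)%R ->
  ((1 + eta) * quad B x)^-1%:E <= V_minfty a x.
Proof.
move=> eta0 aB B1; apply: V_minfty_ge => i.
have q0 : (0 < quad B x)%R by apply: lt_le_trans (quad_ge B x); exact: lt_le_trans B1.
have n0 : (0 <= enorm (x - a i) ^+ 2)%R by rewrite sqr_ge0.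
rewrite inver; case: eqVneq => [_|nz]; first exact: leey.
have n1 : (0 < enorm (x - a i) ^+ 2)%R by rewrite lt0r nz.
have e1 : (0 < (1 + eta) * quad B x)%R by rewrite mulr_gt0// addr_gt0.
rewrite lee_fin lef_pV2 ?posrE//.
rewrite enorm_sqr.
have h : (\sum_j (x - a i) 0 j ^+ 2 <=
    \sum_j ((1 + eta) * x 0 j ^+ 2 + (1 + eta) / eta * a i 0 j ^+ 2))%R.
  apply: ler_sum => j _; rewrite !mxE -subr_ge0.
  have -> : ((1 + eta) * x 0 j ^+ 2 + (1 + eta) / eta * a i 0 j ^+ 2 -
      (x 0 j - a i 0 j) ^+ 2 = (eta * x 0 j + a i 0 j) ^+ 2 / eta)%R.
    by field; rewrite gt_eqF.
  by rewrite divr_ge0 ?sqr_ge0// ltW.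
apply: le_trans h _; rewrite big_split /= -!mulr_sumr /quad mulrDr addrC.
rewrite lerD2r -mulrA ler_wpM2l ?addr_ge0 ?(ltW eta0)// ler_pdivrMl//.
Qed.

End potential.

Section sharpness.
Context (R : realType) (N n : nat) (a : 'I_n -> 'rV[R]_N).
Hypothesis hN : (3 <= N)%N.
Local Notation mu := (vol R N).

Lemma weak_partial0 i : weak_partial i (fun=> 0) (fun=> 0 : R) (N := N).
Proof.
move=> phi _; rewrite /Rintegral.
by under eq_integral do rewrite mul0r; under [in RHS]eq_integral do rewrite mul0r;
  rewrite integral0 oppr0.
Qed.

Lemma L2_real (f : 'rV[R]_N -> R) : measurable_fun setT f ->
  mu.-integrable setT (fun x => (f x ^+ 2)%:E) -> L2 (fun x => (f x)%:C%C).
Proof.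
move=> mf fi; split.
  exact: (@sqr_Lfun2 _ _ _ (lebesgue_rv R N) f mf fi).
apply: (@sqr_Lfun2 _ _ _ (lebesgue_rv R N) (fun=> 0)); first exact: measurable_cst.
rewrite (_ : (fun x => _) = cst 0%E); last by apply/funext => x; rewrite expr0n.
exact: integrable0.
Qed.

(** If the inequality held with [C], the trial functions with damping [s] would
    satisfy [C' \int Q s^2 <= 4 \int Q s^2 (b + 1 - s)^2] for a constant [C']
    with [4 b^2 < C' < C], where [Q] is integrable and positive.  As [s] tends
    to 1 this becomes [(C' - 4 b^2) \int Q <= 0], which is absurd. *)
Lemma sharp_constant (C : R) : (N%:R - 2) ^+ 2 / 4 < C ->
  exists (u : 'rV[R]_N -> R[i]) (g : 'I_N -> 'rV[R]_N -> R[i]),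
    [/\ H1 u, weak_gradient u g &
     ~ (\int[mu]_x (\sum_(i < N) Normc.normc (g i x) ^+ 2)%:E >=
        C%:E *
        \int[mu]_x (V_minfty a x * (Normc.normc (u x) ^+ 2)%:E))%E].
Proof.
move=> hC.
have N2 : 0 < N%:R - 2 :> R by rewrite subr_gt0 ltr_nat.
pose al : R := (N%:R - 2) / 2.
have al0 : 0 < al by rewrite divr_gt0.
have hC' : al ^+ 2 < C by move: hC; congr (_ < _); rewrite /al; field.
have C0 : 0 < C by apply: le_lt_trans hC'; exact: sqr_ge0.
have alC : al < Num.sqrt C.
  by rewrite -(@ltr_pXn2r _ 2)// ?nnegrE ?sqrtr_ge0 ?ltW// sqr_sqrtr// ltW.
(* Any [t] strictly between the square roots of the two constants will do; with
   [b = t / 2], the integrability of [Q] is [al < t] and [4 b^2 = t^2 < C]. *)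
pose t : R := (al + Num.sqrt C) / 2.
have alt : al < t by rewrite /t; lra.
have t0 : 0 < t by exact: lt_trans alt.
have tC : t ^+ 2 < C.
  rewrite -[X in _ < X](sqr_sqrtr (ltW C0)) ltr_pXn2r ?nnegrE ?sqrtr_ge0 ?(ltW t0)//.
  by rewrite /t; lra.
(* Half of the relative gap between [t ^+ 2] and [C], so that [C' > t ^+ 2]. *)
pose eta : R := (C / t ^+ 2 - 1) / 2.
have t20 : 0 < t ^+ 2 by rewrite exprn_gt0.
have eta0 : 0 < eta by rewrite divr_gt0// subr_gt0 ltr_pdivlMr// mul1r.
pose C' : R := C / (1 + eta).
have e1 : 0 < 1 + eta by rewrite addr_gt0.
have C'E : C = C' * (1 + eta) by rewrite /C' mulfVK// gt_eqF.
have tC' : t ^+ 2 < C'.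
  rewrite /C' ltr_pdivlMr//; have : C = t ^+ 2 * (1 + 2 * eta).
    by rewrite /eta; field; rewrite gt_eqF.
  by move=> ->; rewrite ltr_pM2l//; lra.
pose b : R := t / 2.
have b0 : 0 < b by rewrite divr_gt0.
pose B : R := 1 + (\sum_i \sum_j a i 0 j ^+ 2) / eta.
have sum0 : 0 <= \sum_i \sum_j a i 0 j ^+ 2.
  by apply: sumr_ge0 => i _; apply: sumr_ge0 => j _; exact: sqr_ge0.
have B1 : 1 <= B by rewrite lerDl divr_ge0// ltW.
have aB i : \sum_j a i 0 j ^+ 2 <= eta * B.
  have -> : eta * B = eta + \sum_i \sum_j a i 0 j ^+ 2.
    by rewrite /B; field; rewrite gt_eqF.
  have : \sum_j a i 0 j ^+ 2 <= \sum_i \sum_j a i 0 j ^+ 2.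
    rewrite [leRHS](bigD1 i)//= lerDl sumr_ge0// => k _.
    by apply: sumr_ge0 => j _; exact: sqr_ge0.
  by lra.
have hb : N%:R < 2 * (2 * b + 1) by move: alt; rewrite /b /al; lra.
pose d (k : nat) : R := k.+1%:R^-1.
have d0 k : 0 < d k by rewrite invr_gt0.
pose s k := damping B (d k) : 'rV[R]_N -> R.
pose Q (x : 'rV[R]_N) := decay (2 * b + 1) (quad B x).
have q0 (x : 'rV[R]_N) : 0 < quad B x.
  exact: lt_le_trans (lt_le_trans ltr01 B1) (quad_ge B x).
have Q0 x : 0 < Q x by exact: decay_gt0.
have iQ : mu.-integrable setT (fun x => (Q x)%:E) := integrable_decay B1 hb.
have mQ : measurable_fun setT Q by exact: measurable_decay.
have ms k : measurable_fun setT (s k).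
  apply: (measurableT_comp (@measurable_invr R)).
  by apply: measurable_funD => //; apply: measurable_funM => //; exact: measurable_quad.
have s01 k x : 0 < s k x <= 1 by rewrite damping_gt0 ?damping_le1.
have iQc (c : R) (h : 'rV[R]_N -> R) : measurable_fun setT h ->
    (forall x, `|h x| <= c) -> mu.-integrable setT (fun x => (Q x * h x)%:E).
  move=> mh hc; apply: le_integrable (integrableZl measurableT c iQ) => //.
    by apply/measurable_EFinP; exact: measurable_funM.
  move=> x _; rewrite /= lee_fin !normrM [leRHS]mulrC ler_wpM2l//.
  exact: le_trans (hc x) (ler_norm _).
apply: contrapT => nosharp.
have s2 k x : 0 <= s k x ^+ 2 <= 1.
  have /andP[s0 s1] := s01 k x; rewrite sqr_ge0 -[leRHS](expr1n _ 2).
  by rewrite lerXn2r ?nnegrE// ltW.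
have b1s k x : 0 <= (b + 1 - s k x) ^+ 2 <= (b + 1) ^+ 2.
  have /andP[s0 s1] := s01 k x; rewrite sqr_ge0 lerXn2r ?nnegrE//; have := b0; lra.
have i1 k : mu.-integrable setT (fun x => (Q x * s k x ^+ 2)%:E).
  apply: (iQc 1); first exact: measurable_funX.
  by move=> x; have /andP[? ?] := s2 k x; rewrite ger0_norm.
have i2 k : mu.-integrable setT
    (fun x => (Q x * (4 * (s k x ^+ 2 * (b + 1 - s k x) ^+ 2)))%:E).
  apply: (iQc (4 * (b + 1) ^+ 2)).
    apply: measurable_funM => //; apply: measurable_funM; first exact: measurable_funX.
    by apply: measurable_funX; exact: measurable_funB.
  move=> x; have /andP[? ?] := s2 k x; have /andP[? ?] := b1s k x.
  have h0 : 0 <= s k x ^+ 2 * (b + 1 - s k x) ^+ 2 by exact: mulr_ge0.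
  rewrite ger0_norm; last exact: mulr_ge0.
  by rewrite ler_wpM2l// -[leRHS]mul1r; exact: ler_pM.
(* The assumed inequality for the trial function of index [k], after replacing
   both integrands by their bounds. *)
have main k : (C'%:E * \int[mu]_x (Q x * s k x ^+ 2)%:E <=
    \int[mu]_x (Q x * (4 * (s k x ^+ 2 * (b + 1 - s k x) ^+ 2)))%:E)%E.
  pose u (x : 'rV[R]_N) : R[i] := (trial B b (d k) x)%:C%C.
  pose g (i : 'I_N) (x : 'rV[R]_N) : R[i] := (dtrial B b (d k) i x)%:C%C.
  have ct : continuous (trial B b (d k) : 'rV[R]_N -> R) by exact: continuous_trial.
  have cdt i : continuous (dtrial B b (d k) i : 'rV[R]_N -> R).
    exact: continuous_dtrial.
  have Lu : L2 u.
    apply: L2_real; first exact: continuous_measurable_rv.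
    exact: integrable_trial_sqr.
  have wg : weak_gradient u g.
    move=> i; split.
    - apply: L2_real; first exact: continuous_measurable_rv.
      exact: integrable_dtrial_sqr.
    - have h : weak_partial i (trial B b (d k)) (dtrial B b (d k) i).
        by apply: weak_partial_classical => // x; exact: is_derive_trial.
      exact: h.
    - exact: weak_partial0.
  have key : (\int[mu]_x (\sum_(i < N) Normc.normc (g i x) ^+ 2)%:E >=
      C%:E * \int[mu]_x (V_minfty a x * (Normc.normc (u x) ^+ 2)%:E))%E.
    apply: contrapT => h; apply: nosharp; exists u, g; split=> //.
    by split=> //; exists g.
  apply: (@le_trans _ _ (C%:E * \int[mu]_x (V_minfty a x * (Normc.normc (u x) ^+ 2)%:E))%E).
    have -> : (C%:E = C'%:E * (1 + eta)%:E)%E by rewrite -EFinM -C'E.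
    rewrite -muleA; apply: lee_wpmul2l; first by rewrite lee_fin (ltW (lt_trans t20 tC')).
    have -> : (\int[mu]_x (Q x * s k x ^+ 2)%:E =
        (1 + eta)%:E * \int[mu]_x ((1 + eta)^-1%:E * (Q x * s k x ^+ 2)%:E))%E.
      rewrite integralZl//.
      by rewrite muleA -EFinM mulfV ?gt_eqF// mul1e.
    rewrite lee_wpmul2l ?lee_fin ?(ltW e1)//; apply: le_ge0_integral => x _.
      by rewrite -EFinM lee_fin mulr_ge0 ?invr_ge0 ?(ltW e1)// mulr_ge0 ?sqr_ge0// ltW.
    rewrite normc_sqr /= expr0n addr0 trial_sqr//.
    apply: le_trans (lee_wpmul2r _ (V_minfty_ge_quad x eta0 aB B1)) => //; last first.
      by rewrite lee_fin mulr_ge0 ?(ltW (q0 x))// mulr_ge0 ?sqr_ge0// ltW// Q0.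
    rewrite -!EFinM lee_fin le_eqVlt; apply/orP; left; apply/eqP.
    by rewrite -/(Q x) -/(s k x); field; rewrite !gt_eqF.
  apply: le_trans key _; apply: le_ge0_integral => x _.
    by rewrite lee_fin sumr_ge0// => i _; exact: sqr_ge0.
  rewrite lee_fin; under eq_bigr do rewrite normc_sqr /= expr0n addr0.
  apply: le_trans (dtrial_sqr b (d k) B1 x) _.
  by rewrite -/(Q x) -/(s k x) le_eqVlt; apply/orP; left; apply/eqP; ring.
pose f k x := (Q x * (s k x ^+ 2 * (C' - 4 * (b + 1 - s k x) ^+ 2)))%:E.
have intf k : (\int[mu]_x f k x <= 0)%E.
  have -> : (\int[mu]_x f k x = \int[mu]_x (C'%:E * (Q x * s k x ^+ 2)%:E -
      (Q x * (4 * (s k x ^+ 2 * (b + 1 - s k x) ^+ 2)))%:E))%E.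
    by apply: eq_integral => x _; rewrite /f -EFinM -EFinB; congr EFin; ring.
  rewrite integralB//; last exact: integrableZl.
  rewrite integralZl// leeBlDr ?add0e//; exact: integrable_fin_num.
have mf k : measurable_fun setT (f k).
  apply/measurable_EFinP; apply: measurable_funM => //.
  apply: measurable_funM; first exact: measurable_funX.
  apply: measurable_funB => //; apply: measurable_funM => //.
  by apply: measurable_funX; exact: measurable_funB.
have C'0 : 0 <= C' by exact: ltW (lt_trans t20 tC').
have dom x k : (`|f k x| <= (Q x * (C' + 4 * (b + 1) ^+ 2))%:E)%E.
  rewrite lee_fin normrM (gtr0_norm (Q0 x)) ler_wpM2l ?(ltW (Q0 x))//.
  have /andP[s20 s21] := s2 k x; have /andP[bs0 bs1] := b1s k x.
  rewrite normrM (ger0_norm s20) -[leRHS]mul1r ler_pM//.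
  by rewrite ler_norml; apply/andP; split; lra.
have lim x : f ^~ x @ \oo --> (Q x * (C' - 4 * b ^+ 2))%:E.
  have cs : s k x @[k --> \oo] --> (1 : R).
    have h : (1 + d k * quad B x) @[k --> \oo] --> (1 + 0 * quad B x : R).
      by apply: cvgD; [exact: cvg_cst|apply: cvgMl; exact: cvg_harmonic].
    have n0 : 1 + 0 * quad B x != 0 by rewrite mul0r addr0.
    by have := cvgV n0 h; rewrite mul0r addr0 invr1; exact.
  apply: cvg_EFin; first by apply: nearW.
  have h1 : (b + 1 - s k x) @[k --> \oo] --> b + 1 - 1.
    by apply: cvgB; [exact: cvg_cst|].
  have h2 : (C' - 4 * (b + 1 - s k x) ^+ 2) @[k --> \oo] --> C' - 4 * (b + 1 - 1) ^+ 2.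
    by apply: cvgB; [exact: cvg_cst|apply: cvgM; [exact: cvg_cst|exact: cvgM]].
  have := cvgM (cvg_cst (Q x)) (cvgM (cvgM cs cs) h2).
  by rewrite addrK !mul1r; exact.
have [] := @dominated_convergence _ _ _ mu setT measurableT f
  (fun x => (Q x * (C' - 4 * b ^+ 2))%:E)
  (fun x => (Q x * (C' + 4 * (b + 1) ^+ 2))%:E).
- exact: mf.
- by apply/measurable_EFinP; exact: measurable_funM.
- by apply: aeW => x _; exact: lim.
- exact: (iQc `|C' + 4 * (b + 1) ^+ 2|).
- by apply: aeW => x k _; exact: dom.
move=> _ _ cvgint.
have c0 : 0 < C' - 4 * b ^+ 2.
  by rewrite subr_gt0; move: tC'; congr (_ < _); rewrite /b; field.
have : (\int[mu]_x (Q x * (C' - 4 * b ^+ 2))%:E <= 0)%E.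
  rewrite -(cvg_lim _ cvgint)//; apply: lime_le.
    by apply/cvg_ex; eexists; exact: cvgint.
  by apply: nearW => k; exact: intf.
apply/negP; rewrite -ltNge.
(* The limiting integrand is positive, with a positive lower bound on the unit
   cube. *)
have BN : 0 < B + N%:R by rewrite ltr_pwDl// (lt_le_trans ltr01).
have m0 : 0 < decay (2 * b + 1) (B + N%:R) * (C' - 4 * b ^+ 2).
  by rewrite mulr_gt0// decay_gt0.
have mc := @measurable_cube R N 1.
apply: (@lt_le_trans _ _ (\int[mu]_(x in cube N 1)
    (decay (2 * b + 1) (B + N%:R) * (C' - 4 * b ^+ 2))%:E)%E).
  rewrite integral_cst// [X in (_ * X)%E](_ : _ = ((2 * 1) ^+ N)%:E); last exact: vol_cube.
  by rewrite -EFinM lte_fin mulr_gt0// exprn_gt0// mulr1.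
rewrite integral_mkcond; apply: le_ge0_integral => x _; rewrite patchE.
  by case: ifPn => // _; rewrite lee_fin ltW.
case: ifPn => [/set_mem x1|_].
- rewrite lee_fin ler_wpM2r ?(ltW c0)//; apply: decay_le; [by have := b0; lra|exact: q0|].
  rewrite /quad lerD2l.
  have -> : N%:R = \sum_(i < N) (1 : R) by rewrite sumr_const card_ord.
  apply: ler_sum => i _; have := x1 i; rewrite in_itv/= => /andP[h1 h2]; nra.
- by rewrite lee_fin mulr_ge0 ?(ltW c0) ?(ltW (Q0 x)).
Qed.

End sharpness.

(** * The inequality for the farthest pole *)
Lemma L2_sqr (R : realType) (N : nat) (u : 'rV[R]_N -> R[i]) : L2 u ->
  [/\ measurable_fun setT (@complex.Re R \o u),
      (vol R N).-integrable setT (fun x => (complex.Re (u x) ^+ 2)%:E),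
      measurable_fun setT (@complex.Im R \o u) &
      (vol R N).-integrable setT (fun x => (complex.Im (u x) ^+ 2)%:E)].
Proof.
by move=> [/Lfun2_sqr[mr ir] /Lfun2_sqr[mi ii]]; split.
Qed.

(** The potential of the farthest pole is at most that of the first one;
    the squared moduli split into real and imaginary parts. *)
Lemma hardy_farthest_pole (R : realType) (N n : nat) (a : 'I_n -> 'rV[R]_N)
    (u : 'rV[R]_N -> R[i]) (g : 'I_N -> 'rV[R]_N -> R[i]) :
  (3 <= N)%N -> (1 <= n)%N -> L2 u -> weak_gradient u g ->
  (((N%:R - 2) ^+ 2 / 4)%:E *
   \int[vol R N]_x (V_minfty a x * (Normc.normc (u x) ^+ 2)%:E) <=
   \int[vol R N]_x (\sum_(i < N) Normc.normc (g i x) ^+ 2)%:E)%E.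
Proof.
move=> hN hn Lu wg; have [mr ir mi ii] := L2_sqr Lu.
have hg i := L2_sqr (let: And3 h _ _ := wg i in h).
have wr i : weak_partial i (@complex.Re R \o u) (@complex.Re R \o g i) by have [] := wg i.
have wi i : weak_partial i (@complex.Im R \o u) (@complex.Im R \o g i) by have [] := wg i.
have mgr i : measurable_fun setT (@complex.Re R \o g i) by have [] := hg i.
have mgi i : measurable_fun setT (@complex.Im R \o g i) by have [] := hg i.
have igr i : (vol R N).-integrable setT (fun x => (complex.Re (g i x) ^+ 2)%:E).
  by have [] := hg i.
have igi i : (vol R N).-integrable setT (fun x => (complex.Im (g i x) ^+ 2)%:E).
  by have [] := hg i.
pose o : 'I_n := Ordinal hn.
pose W x : \bar R := ((enorm (x - a o) ^+ 2)%:E^-1)%E.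
have W0 x : (0 <= W x)%E by rewrite inve_ge0 lee_fin sqr_ge0.
have mW : measurable_fun setT W.
  apply: measurable_inve_EFin; under eq_fun do rewrite enorm_sqr.
  apply: measurable_sum => j; apply: measurable_funX; under eq_fun do rewrite !mxE.
  by apply: measurable_funB => //; exact: measurable_coord.
have hr := hardy_one_pole hN (a o) mr mgr ir igr wr.
have hi := hardy_one_pole hN (a o) mi mgi ii igi wi.
have c0 : (0 <= ((N%:R - 2) ^+ 2 / 4 : R)%:E)%E by rewrite lee_fin divr_ge0// sqr_ge0.
have sq (f : 'rV[R]_N -> R) : measurable_fun setT f ->
    measurable_fun setT (fun x => (f x ^+ 2)%:E).
  by move=> mf; apply/measurable_EFinP; exact: measurable_funX.
apply: (@le_trans _ _ (((N%:R - 2) ^+ 2 / 4)%:E *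
    (\int[vol R N]_x (W x * (complex.Re (u x) ^+ 2)%:E) +
     \int[vol R N]_x (W x * (complex.Im (u x) ^+ 2)%:E)))%E).
  rewrite lee_wpmul2l// -ge0_integralD//; last 4 first.
  - by move=> x _; rewrite mule_ge0// lee_fin sqr_ge0.
  - by apply: emeasurable_funM => //; exact: (sq _ mr).
  - by move=> x _; rewrite mule_ge0// lee_fin sqr_ge0.
  - by apply: emeasurable_funM => //; exact: (sq _ mi).
  apply: le_ge0_integral => x _.
    by rewrite mule_ge0// ?V_minfty_ge0// lee_fin sqr_ge0.
  rewrite -ge0_muleDr ?lee_fin ?sqr_ge0// normc_sqr -EFinD.
  by rewrite lee_wpmul2r ?V_minfty_le// lee_fin addr_ge0 ?sqr_ge0.
rewrite ge0_muleDr; last 2 first.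
- by apply: integral_ge0 => x _; rewrite mule_ge0// lee_fin sqr_ge0.
- by apply: integral_ge0 => x _; rewrite mule_ge0// lee_fin sqr_ge0.
apply: le_trans (leeD hr hi) _; rewrite -ge0_integralD//; last 4 first.
- by move=> x _; rewrite lee_fin sumr_ge0// => i _; exact: sqr_ge0.
- by apply/measurable_EFinP; apply: measurable_sum => i; exact: measurable_funX.
- by move=> x _; rewrite lee_fin sumr_ge0// => i _; exact: sqr_ge0.
- by apply/measurable_EFinP; apply: measurable_sum => i; exact: measurable_funX.
rewrite le_eqVlt; apply/orP; left; apply/eqP; apply: eq_integral => x _.
rewrite -EFinD -big_split /=; congr EFin; apply: eq_bigr => i _.
by rewrite normc_sqr.
Qed.

Theorem theorem2p2 (R : realType) (N n : nat) (a : 'I_n -> 'rV[R]_N)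
    (hN : (3 <= N)%N) (hn : (1 <= n)%N) (ha : injective a) :
  (forall (u : 'rV[R]_N -> R[i]) (g : 'I_N -> 'rV[R]_N -> R[i]),
    H1 u -> weak_gradient u g ->
    (\int[lebesgue_rv R N]_x (\sum_(i < N) Normc.normc (g i x) ^+ 2)%:E >=
     ((N%:R - 2) ^+ 2 / 4)%:E *
     \int[lebesgue_rv R N]_x (V_minfty a x * (Normc.normc (u x) ^+ 2)%:E))%E) /\
  (forall C : R, (N%:R - 2) ^+ 2 / 4 < C ->
    exists (u : 'rV[R]_N -> R[i]) (g : 'I_N -> 'rV[R]_N -> R[i]),
      [/\ H1 u, weak_gradient u g &
       ~ (\int[lebesgue_rv R N]_x (\sum_(i < N) Normc.normc (g i x) ^+ 2)%:E >=
          C%:E *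
          \int[lebesgue_rv R N]_x (V_minfty a x * (Normc.normc (u x) ^+ 2)%:E))%E]).
Proof.
split=> [u g [Lu _] wg|C hC]; last exact: sharp_constant.
exact: hardy_farthest_pole.
Qed.
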